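(* Let $\mathbf{k}_0$ be an uncountable field of characteristic zero, $\mathbf{k}_1$ a function field over $\mathbf{k}_0$, and $\mathbf{k}_2$ the algebraic closure of $\mathbf{k}_1$. Consider the polynomial rings $B_0\subset B_1\subset B_2$, where $B_i=\mathbf{k}_i[X,Y]$ is a polynomial ring in two variables over $\mathbf{k}_i$. Then there exist degree functions $$\deg_0 : B_0\to\mathbb{N}\cup\{-\infty\},\quad \deg_1 : B_1\to\mathbb{N}\cup\{-\infty\}\quad\text{and}\quad \deg_2 : B_2\to\mathbb{Z}\cup\{-\infty\}$$ satisfying the following conditions: (a) if $i\le j$ then $\deg_i$ is the restriction of $\deg_j$; (b) for each $i=0,1,2$, $\deg_i(\lambda)=0$ for all $\lambda\in\mathbf{k}_i^*$; (c) $\deg_0$ is determined by the grading $B_0=\bigoplus_{i\in\mathbb{N}}R_i$ of $B_0$ (as a $\mathbf{k}_0$-algebra with $R_0=\mathbf{k}_0$) defined by $X\in R_2$ and $Y\in R_3$ but, for each $i=1,2$, $\deg_i$ is not determined by a grading of $B_i$; (d) $\operatorname{Gr}(B_i)$ (formed with respect to $\deg_i$) is finitely generated as a $\mathbf{k}_i$-algebra if $i\in\{0,2\}$, but not if $i=1$; (e) $\deg_i(D_i)$ is defined if $i=0$ but not if $i\in\{1,2\}$, where $D_i=\frac{\partial}{\partial Y} : B_i\to B_i$.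
   Context: $\mathbb{N}$ includes $0$. A function field over a field is a finitely generated field extension of transcendence degree at least $1$. A degree function on a ring $B$ with values in a totally ordered abelian group $G$ is a map $\deg : B \to G\cup\{-\infty\}$ such that for all $x,y\in B$: (1) $\deg(x)=-\infty$ iff $x=0$; (2) $\deg(xy)=\deg x+\deg y$; (3) $\deg(x+y)\le\max(\deg x,\deg y)$. A degree function $B\to\mathbb{N}\cup\{-\infty\}$ is a degree function with $G=\mathbb{Z}$ whose values on $B\setminus\{0\}$ lie in $\mathbb{N}$. For a derivation $D:B\to B$ of an integral domain $B$ with degree function $\deg$, let $U=\{\deg(Dx)-\deg(x) : x\in B\setminus\{0\}\}\subseteq G\cup\{-\infty\}$. If $U$ has a greatest element, $\deg(D)$ is defined to be that element; otherwise $\deg(D)$ is said to be not defined. Degree function determined by a grading: if $B=\bigoplus_{i\in G}B_i$ is a $G$-grading of the domain $B$, the degree function determined by it sends $x=\sum_i x_i$ ($x_i\in B_i$) to the greatest element of $\{i\in G: x_i\ne0\}\cup\{-\infty\}$. Here $G=\mathbb{Z}$ (an $\mathbb{N}$-grading being a $\mathbb{Z}$-grading with zero components in negative degrees). Associated graded ring: for $i\in G$ put $B_{\le i}=\{x\in B:\deg(x)\le i\}$, $B_{<i}=\{x\in B:\deg(x)<i\}$, $B_{[i]}=B_{\le i}/B_{<i}$; then $\operatorname{Gr}(B)=\bigoplus_{i\in G}B_{[i]}$, a $G$-graded integral domain with multiplication induced by that of $B$. When a field $\mathbf{k}\subseteq B$ has all its nonzero elements of degree $0$, $\operatorname{Gr}(B)$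 is a $\mathbf{k}$-algebra via $\mathbf{k}\to B_{\le 0}\to B_{[0]}$. *)

(* Defs.v *)
From HB Require Import structures.
From mathcomp Require Import all_boot all_order all_algebra.
From mathcomp Require Import finmap.
From mathcomp Require Import mpoly.
From mathcomp Require classical_sets cardinality.

Set Implicit Arguments.
Unset Strict Implicit.
Unset Printing Implicit Defensive.

Import Order.TTheory GRing.Theory Num.Theory.
Local Open Scope ring_scope.

Definition uncountable (T : Type) : Prop :=
  ~~ cardinality.countable (@classical_sets.setT T).

Section FieldExtensions.
Variables (k L : fieldType) (iota : {rmorphism k -> L}).

Record intermediate_field (S : L -> Prop) : Prop := {
  intermediate_base : forall c, S (iota c);
  intermediate_sub : forall x y, S x -> S y -> S (x - y);
  intermediate_mul : forall x y, S x -> S y -> S (x * y);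
  intermediate_inv : forall x, S x -> S x^-1
}.

Definition adjoin (A : L -> Prop) (x : L) : Prop :=
  forall S, intermediate_field S -> (forall a, A a -> S a) -> S x.

Definition finitely_generated_field : Prop :=
  exists s : seq L, forall x, adjoin (fun a => a \in s) x.

Definition algebraically_independent n (t : 'I_n -> L) : Prop :=
  forall p : {mpoly k[n]}, mmap iota t p = 0 -> p = 0.

Definition algebraic_over_subfield (S : L -> Prop) (x : L) : Prop :=
  exists p : {poly L}, [/\ p != 0, forall i, S p`_i & root p x].

Definition transcendence_basis n (t : 'I_n -> L) : Prop :=
  algebraically_independent t /\
  forall x, algebraic_over_subfield (adjoin (fun a => exists i, a = t i)) x.

Definition has_trdeg n : Prop := exists t : 'I_n -> L, transcendence_basis t.

Definition function_field : Prop :=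
  finitely_generated_field /\ exists2 n, (0 < n)%N & has_trdeg n.

End FieldExtensions.

Definition algebraic_closure (k : fieldType) (K : closedFieldType)
    (iota : {rmorphism k -> K}) : Prop :=
  forall z : K, algebraicOver iota z.

(******************************************************************************)
(* Degrees live in Z U {-oo}, encoded as [option int] with [None] for -oo.    *)
(******************************************************************************)

Definition dle (a b : option int) : bool :=
  match a, b with
  | None, _ => true
  | Some _, None => false
  | Some i, Some j => i <= j
  end.

Definition dlt (a b : option int) : bool := ~~ dle b a.

Definition dmax (a b : option int) : option int := if dle a b then b else a.

Definition dadd (a b : option int) : option int :=
  if a is Some i then if b is Some j then Some (i + j) else None else None.

(* a - b; only meaningful when b is not -oo *)
Definition dsub (a b : option int) : option int :=
  if a is Some i then if b is Some j then Some (i - j) else None else None.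

Definition is_greatest (U : option int -> Prop) (u : option int) : Prop :=
  U u /\ forall v, U v -> dle v u.

Record is_degree_function (B : comNzRingType) (deg : B -> option int) : Prop := {
  degree_eqNinfty : forall x, deg x = None <-> x = 0;
  degreeM : forall x y, deg (x * y) = dadd (deg x) (deg y);
  degreeD : forall x y, dle (deg (x + y)) (dmax (deg x) (deg y))
}.

Record degree_function (B : comNzRingType) := DegreeFunction {
  degf :> B -> option int;
  degfP : is_degree_function degf
}.

Definition nat_valued (B : comNzRingType) (deg : degree_function B) : Prop :=
  forall x i, deg x = Some i -> 0 <= i.

Section DerivationDegree.
Variables (B : comNzRingType) (deg : degree_function B) (D : B -> B).

Definition is_derivation_degree : option int -> Prop :=
  is_greatest (fun u => exists2 x, x != 0 & u = dsub (deg (D x)) (deg x)).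

Definition derivation_degree_defined : Prop :=
  exists u, is_derivation_degree u.

End DerivationDegree.

Section Gradings.
Variables (B : comNzRingType) (R : int -> B -> Prop).

Definition homogeneous_decomposition (x : B) (f : {fsfun int -> B with 0}) :=
  (forall i, R i (f i)) /\ x = \sum_(i <- finsupp f) f i.

Record is_grading : Prop := {
  grading0 : forall i, R i 0;
  gradingB : forall i x y, R i x -> R i y -> R i (x - y);
  gradingM : forall i j x y, R i x -> R j y -> R (i + j) (x * y);
  grading_direct : forall x, exists! f, homogeneous_decomposition x f
}.

Definition determined_by_grading (deg : degree_function B) : Prop :=
  forall x f, homogeneous_decomposition x f ->
  is_greatest (fun u => u = None \/ exists2 i, u = Some i & f i != 0) (deg x).

End Gradings.

Definition not_determined_by_a_grading (B : comNzRingType)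
    (deg : degree_function B) : Prop :=
  ~ exists R : int -> B -> Prop, is_grading R /\ determined_by_grading R deg.

(* [X] is 'X_0 and [Y] is 'X_1. *)
Definition XY_weight23_grading (k : fieldType)
    (R : int -> {mpoly k[2]} -> Prop) : Prop :=
  [/\ is_grading R,
      forall i p, i < 0 -> R i p -> p = 0,
      forall p, R 0 p <-> exists c : k, p = c%:MP,
      R 2 'X_0 &
      R 3 'X_1].

(******************************************************************************)
(* The associated graded ring.  The direct sum of the B_{<= i} is the subring *)
(* [rees] of B[t, t^-1] formed by the sums of the x_i t^i with deg x_i <= i,  *)
(* and the direct sum of the B_{< i} is an ideal of it; Gr(B), which is the   *)
(* direct sum of the B_{<= i} / B_{< i}, is the quotient.                     *)
(******************************************************************************)

Section Laurent.
Variable B : comNzRingType.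

Definition laurent := {fsfun int -> B with 0}.
HB.instance Definition _ := Choice.copy laurent {fsfun int -> B with 0}.

Implicit Types f g h : laurent.

Definition lterm (i : int) (x : B) : laurent := [fsfun j in [fset i]%fset => x].
Definition ladd f g : laurent :=
  [fsfun i in (finsupp f `|` finsupp g)%fset => f i + g i].
Definition lopp f : laurent := [fsfun i in finsupp f => - f i].
Definition lmul f g : laurent :=
  [fsfun n in [fset (i + j)%R | i in finsupp f, j in finsupp g]%fset =>
    \sum_(i <- finsupp f) \sum_(j <- finsupp g | i + j == n) f i * g j].

Lemma ltermE i x j : lterm i x j = if j == i then x else 0.
Proof. by rewrite fsfunE inE. Qed.

Lemma laddE f g i : ladd f g i = f i + g i.
Proof.
rewrite fsfunE inE; case: ifPn => //; rewrite negb_or => /andP[hf hg].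
by rewrite !fsfun_dflt // addr0.
Qed.

Lemma loppE f i : lopp f i = - f i.
Proof. by rewrite fsfunE; case: finsuppP; rewrite ?oppr0. Qed.

Lemma lmulE f g n : lmul f g n =
  \sum_(i <- finsupp f) \sum_(j <- finsupp g) (f i * g j) *+ (i + j == n).
Proof.
have E : \sum_(i <- finsupp f) \sum_(j <- finsupp g | i + j == n) f i * g j =
    \sum_(i <- finsupp f) \sum_(j <- finsupp g) (f i * g j) *+ (i + j == n).
  by apply: eq_bigr => i _; rewrite big_mkcond; apply: eq_bigr => j _; rewrite mulrb.
rewrite fsfunE E; case: ifPn => // hn; symmetry.
rewrite big_seq big1 // => i hi; rewrite big_seq big1 // => j hj.
case: eqP => // eij; case/negP: hn; rewrite -eij; exact: in_imfset2.
Qed.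

Lemma lmul_sum (phi : int -> B) g h :
  \sum_(l <- finsupp (lmul g h)) phi l * lmul g h l =
  \sum_(i <- finsupp g) \sum_(j <- finsupp h) phi (i + j) * (g i * h j).
Proof.
rewrite (big_fset_incl _ (finsupp_sub _ _ _)); last first.
  by move=> x _ hx; rewrite (fsfun_dflt hx) mulr0.
under eq_bigr do rewrite lmulE mulr_sumr.
rewrite exchange_big big_seq [RHS]big_seq; apply: eq_bigr => i hi.
under eq_bigr do rewrite mulr_sumr.
rewrite exchange_big big_seq [RHS]big_seq; apply: eq_bigr => j hj.
rewrite (bigD1_seq (i + j)) /=; last 2 first.
- exact: in_imfset2.
- exact: fset_uniq.
rewrite eqxx mulr1n big1 ?addr0 // => l; rewrite eq_sym => /negPf->.
by rewrite mulr0n mulr0.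
Qed.

Lemma laddA : associative ladd.
Proof. by move=> f g h; apply/fsfunP => i; rewrite !laddE addrA. Qed.

Lemma laddC : commutative ladd.
Proof. by move=> f g; apply/fsfunP => i; rewrite !laddE addrC. Qed.

Lemma ladd0 : left_id (lterm 0 0) ladd.
Proof. by move=> f; apply/fsfunP => i; rewrite laddE ltermE if_same add0r. Qed.

Lemma laddN : left_inverse (lterm 0 0) lopp ladd.
Proof.
by move=> f; apply/fsfunP => i; rewrite laddE loppE ltermE if_same addNr.
Qed.

Lemma lmulC : commutative lmul.
Proof.
move=> f g; apply/fsfunP => n; rewrite !lmulE exchange_big.
by apply: eq_bigr => j _; apply: eq_bigr => i _; rewrite mulrC addrC.
Qed.

Lemma lmul_lmulE f g h n : lmul f (lmul g h) n =
  \sum_(i <- finsupp f) \sum_(j <- finsupp g) \sum_(k <- finsupp h)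
    (f i * (g j * h k)) *+ (i + (j + k) == n).
Proof.
rewrite lmulE; apply: eq_bigr => i _.
under eq_bigr do rewrite -mulrnAl.
rewrite (lmul_sum (fun l => f i *+ (i + l == n))).
by apply: eq_bigr => j _; apply: eq_bigr => k _; rewrite mulrnAl.
Qed.

Lemma lmulA : associative lmul.
Proof.
move=> f g h; rewrite [RHS]lmulC; apply/fsfunP => n; rewrite !lmul_lmulE.
rewrite [RHS]exchange_big; apply: eq_bigr => i _.
rewrite [RHS]exchange_big; apply: eq_bigr => j _.
apply: eq_bigr => k _.
by rewrite (addrC k) addrA (mulrC (h k)) mulrA.
Qed.

Lemma lmul_incl (F G : {fset int}) f g n :
  (finsupp f `<=` F)%fset -> (finsupp g `<=` G)%fset ->
  lmul f g n = \sum_(i <- F) \sum_(j <- G) (f i * g j) *+ (i + j == n).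
Proof.
move=> hF hG; rewrite lmulE (big_fset_incl _ hF); last first.
  move=> i _ hi; apply: big1 => j _.
  by rewrite (fsfun_dflt hi) mul0r mul0rn.
apply: eq_bigr => i _; rewrite (big_fset_incl _ hG) // => j _ hj.
by rewrite (fsfun_dflt hj) mulr0 mul0rn.
Qed.

Lemma lmulDl : left_distributive lmul ladd.
Proof.
move=> f g h; apply/fsfunP => n; rewrite laddE.
pose F := (finsupp f `|` finsupp g)%fset.
rewrite (@lmul_incl F (finsupp h)) ?finsupp_sub ?fsubset_refl //.
rewrite (@lmul_incl F (finsupp h) f) ?fsubsetUl ?fsubset_refl //.
rewrite (@lmul_incl F (finsupp h) g) ?fsubsetUr ?fsubset_refl //.
rewrite -big_split; apply: eq_bigr => i _ /=.
rewrite -big_split; apply: eq_bigr => j _ /=.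
by rewrite laddE mulrDl mulrnDl.
Qed.

Lemma lterm_supp i x : (finsupp (lterm i x) `<=` [fset i])%fset.
Proof. exact: finsupp_sub. Qed.

Lemma lmul1 : left_id (lterm 0 1) lmul.
Proof.
move=> f; apply/fsfunP => n.
rewrite (lmul_incl _ (lterm_supp _ _) (fsubset_refl _)) big_seq_fset1.
rewrite ltermE eqxx; under eq_bigr do rewrite mul1r add0r.
case: (finsuppP f n) => [hn|hn].
  rewrite big_seq big1 // => j hj.
  by case: eqP hj => // ->; rewrite (negPf hn).
rewrite (bigD1_seq n) ?fset_uniq //= eqxx big1 ?addr0 // => j.
by move/negPf=> ->.
Qed.

Lemma lterm1_neq0 : lterm 0 1 != lterm 0 0.
Proof.
apply/eqP => /fsfunP/(_ 0); rewrite !ltermE eqxx => /eqP.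
by rewrite oner_eq0.
Qed.

HB.instance Definition _ := GRing.isZmodule.Build laurent laddA laddC ladd0 laddN.
HB.instance Definition _ := GRing.Zmodule_isComNzRing.Build laurent
  lmulA lmulC lmul1 lmulDl lterm1_neq0.

End Laurent.

Section AssociatedGraded.
Variables (B : comNzRingType) (deg : degree_function B).

Lemma dle_trans : transitive dle.
Proof. by move=> [j|] [i|] [k|] //=; apply: le_trans. Qed.

Lemma dltSE a i : dlt a (Some i) = dle a (Some (i - 1)).
Proof. by case: a => //= j; rewrite /dlt /= -ltNge lerBrDr lezD1. Qed.

Lemma degree0 : deg 0 = None.
Proof. by apply/(degree_eqNinfty (degfP deg)). Qed.

Lemma degree1 : deg 1 = Some 0.
Proof.
have := degreeM (degfP deg) 1 1; rewrite mulr1.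
case E : (deg 1) => [i|] /=; last first.
  by move/(degree_eqNinfty (degfP deg))/eqP: E; rewrite oner_eq0.
by case=> /eqP; rewrite -subr_eq0 opprD addNKr oppr_eq0 => /eqP->.
Qed.

Lemma degreeN x : deg (- x) = deg x.
Proof.
have hN1 : deg (-1) = Some 0.
  have := degreeM (degfP deg) (-1) (-1); rewrite mulrNN mulr1 degree1.
  by case: (deg (-1)) => //= i [/esym/eqP]; rewrite -mulr2n mulrn_eq0 => /eqP->.
rewrite -mulN1r (degreeM (degfP deg)) hN1.
by case: (deg x) => //= i; rewrite add0r.
Qed.

Lemma dle_degD a x y : dle (deg x) a -> dle (deg y) a -> dle (deg (x + y)) a.
Proof.
move=> hx hy; apply: dle_trans (degreeD (degfP deg) x y) _.
by rewrite /dmax; case: ifP.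
Qed.

Lemma dle_degM i j x y :
  dle (deg x) (Some i) -> dle (deg y) (Some j) -> dle (deg (x * y)) (Some (i + j)).
Proof.
rewrite (degreeM (degfP deg)).
by case: (deg x) => //= ?; case: (deg y) => //= ? hi hj; apply: lerD.
Qed.

Lemma dle_deg_sum a (I : eqType) (r : seq I) (F : I -> B) :
  (forall i, i \in r -> dle (deg (F i)) a) -> dle (deg (\sum_(i <- r) F i)) a.
Proof.
move=> h; rewrite big_seq; elim/big_ind: _ => //; first by rewrite degree0.
by move=> x y; apply: dle_degD.
Qed.

Lemma dle_deg_lmul a b (f g : laurent B) :
  (forall i, dle (deg (f i)) (Some (i - a))) ->
  (forall i, dle (deg (g i)) (Some (i - b))) ->
  forall i, dle (deg ((f * g) i)) (Some (i - (a + b))).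
Proof.
move=> hf hg n; rewrite [f * g]/(lmul f g) lmulE.
apply: dle_deg_sum => i _; apply: dle_deg_sum => j _.
case: eqP => [<-|_]; last by rewrite mulr0n degree0.
by rewrite mulr1n opprD addrACA; apply: dle_degM.
Qed.

Definition rees_pred : {pred laurent B} :=
  fun f => all (fun i => dle (deg (f i)) (Some i)) (finsupp f).

Lemma rees_predP (f : laurent B) :
  reflect (forall i, dle (deg (f i)) (Some i)) (f \in rees_pred).
Proof.
apply: (iffP allP) => h i; last by move=> _; apply: h.
by have [|hi] := boolP (i \in finsupp f); [apply: h | rewrite fsfun_dflt ?degree0].
Qed.

Lemma rees_subring_closed : subring_closed rees_pred.
Proof.
split.
- apply/rees_predP => i; rewrite [1]/(lterm 0 1) ltermE.
  by case: eqP => [->|_]; rewrite ?degree1 ?degree0.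
- move=> f g /rees_predP hf /rees_predP hg; apply/rees_predP => i.
  by rewrite [f - g]/(ladd f (lopp g)) laddE loppE; apply: dle_degD; rewrite ?degreeN.
- move=> f g /rees_predP hf /rees_predP hg; apply/rees_predP => i.
  by have := @dle_deg_lmul 0 0 f g _ _ i; rewrite addr0; apply=> j; rewrite subr0.
Qed.

Definition rees := {f : laurent B | f \in rees_pred}.
HB.instance Definition _ := SubChoice.on rees.
HB.instance Definition _ :=
  GRing.SubChoice_isSubComNzRing.Build (laurent B) rees_pred rees
    rees_subring_closed.

Definition rees_ideal : {pred rees} :=
  fun f => all (fun i => dlt (deg (val f i)) (Some i)) (finsupp (val f)).

Lemma rees_idealP (f : rees) :
  reflect (forall i, dlt (deg (val f i)) (Some i)) (f \in rees_ideal).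
Proof.
apply: (iffP allP) => h i; last by move=> _; apply: h.
have [|hi] := boolP (i \in finsupp (val f)); first exact: h.
by rewrite (fsfun_dflt hi) degree0.
Qed.

Lemma rees_idealr_closed : idealr_closed rees_ideal.
Proof.
split.
- by apply/rees_idealP => i; rewrite [val 0]/(lterm 0 0) ltermE if_same degree0.
- apply/negP => /rees_idealP/(_ 0).
  by rewrite [val 1]/(lterm 0 1) ltermE eqxx degree1.
- move=> f u v /rees_idealP hu /rees_idealP hv; apply/rees_idealP => i.
  rewrite [val _]/(ladd (val f * val u) (val v)) laddE dltSE.
  apply: dle_degD; last by rewrite -dltSE.
  have := @dle_deg_lmul 0 1 (val f) (val u) _ _ i.
  rewrite add0r; apply=> j; last by rewrite -dltSE.
  by rewrite subr0; have /rees_predP := valP f; apply.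
Qed.

HB.instance Definition _ :=
  isIdealr.Build rees rees_ideal rees_idealr_closed.

Definition Gr := {ideal_quot rees_ideal}.
HB.instance Definition _ := GRing.ComNzRing.on Gr.

(* the class in B_[i] of an element x of B_{<= i} *)
Definition gr_class (i : int) (x : B) : Gr :=
  (\pi_Gr (insubd (0 : rees) (lterm i x)))%qT.

Lemma lterm_rees i x : dle (deg x) (Some i) -> lterm i x \in rees_pred.
Proof. move=> h; apply/rees_predP => j; rewrite ltermE; case: eqP => [->|_] //; by rewrite degree0. Qed.

Lemma gr_class_eq0 i x : dle (deg x) (Some i) ->
  gr_class i x = 0 <-> dlt (deg x) (Some i).
Proof.
move=> h; have e : val (insubd (0 : rees) (lterm i x)) = lterm i x by rewrite insubdK // lterm_rees.
have -> : (gr_class i x = 0) <-> (insubd (0 : rees) (lterm i x) \in rees_ideal).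
  rewrite -[X in X \in _]subr0 Quotient.idealrBE /gr_class rmorph0; split=> [->|/eqP] //.
split=> [/rees_idealP/(_ i)|hl]; first by rewrite e ltermE eqxx.
apply/rees_idealP => j; rewrite e ltermE; case: eqP => [->//|_]; by rewrite degree0.
Qed.

Lemma gr_classM i j x y : dle (deg x) (Some i) -> dle (deg y) (Some j) ->
  gr_class i x * gr_class j y = gr_class (i+j) (x*y).
Proof.
move=> hx hy; rewrite /gr_class -rmorphM; congr (\pi _)%qT; apply: val_inj;
  rewrite rmorphM /=.
rewrite !insubdK ?lterm_rees ?dle_degM //; apply/fsfunP => n.
rewrite [_ * _]/(lmul _ _) (lmul_incl _ (lterm_supp _ _) (lterm_supp _ _)) !big_seq_fset1.
by rewrite !ltermE !eqxx eq_sym mulrb.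
Qed.

Lemma gr_classD i x y : dle (deg x) (Some i) -> dle (deg y) (Some i) ->
  gr_class i (x + y) = gr_class i x + gr_class i y.
Proof.
move=> hx hy; rewrite /gr_class -rmorphD; congr (\pi _)%qT; apply: val_inj;
  rewrite rmorphD /=.
rewrite !insubdK ?lterm_rees ?dle_degD //; apply/fsfunP => n.
transitivity (ladd (lterm i x) (lterm i y) n); last by [].
by rewrite laddE !ltermE; case: eqP; rewrite ?addr0.
Qed.

Lemma gr_class1 : gr_class 0 1 = 1.
Proof.
rewrite /gr_class -(rmorph1 (\pi_Gr)%qT); congr (\pi _)%qT; apply: val_inj.
by rewrite insubdK // lterm_rees // degree1.
Qed.

End AssociatedGraded.

Definition finitely_generated_algebra (k A : comNzRingType) (phi : k -> A) :=
  exists n (v : 'I_n -> A), forall a, exists p : {mpoly k[n]}, a = mmap phi v p.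

(* The k-algebra structure of Gr(B) is k -> B_{<= 0} -> B_[0], which makes     *)
(* sense when deg is 0 on the image of k^*.                                   *)
Definition gr_finitely_generated (k B : comNzRingType) (iota : k -> B)
    (deg : degree_function B) : Prop :=
  finitely_generated_algebra (fun c => gr_class deg 0 (iota c)).

(* Main.v *)
Require Import Defs.
From HB Require Import structures.
From mathcomp Require Import all_boot all_order all_algebra.
From mathcomp Require Import finmap.
From mathcomp Require Import mpoly.
From mathcomp Require Import boolp.
From mathcomp Require Import zify ring.

(**
Let u be a formal variable and let deg_2 f be the degree in u of f(u^2, y), where
y = tau u^3 + a_0 u^2 + a_1 u + a_2 + a_3 u^-1 + ... is a Laurent series in 1/u with
tau in k_1 transcendental over k_0 and with each a_n a square root, outside
K_n = k_1(a_0, ..., a_(n-1)), of an element of K_n.  Such a_n exist because K_n is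
finite over a purely transcendental extension of k_0, hence cannot contain all the
2^r-th roots of an indeterminate.

For f over k_1, replace y by its truncation at order n followed by an indeterminate
coefficient Z.  The leading coefficient in u is then a polynomial p_n over K_n, and
deg p_(n+1) is at most the multiplicity of a_n as a root of p_n, hence at most half of
deg p_n, since a_n comes with its conjugate -a_n.  The degree in u drops by at most
that multiplicity too, so the process ends with deg f >= 0.  On k_0[X,Y] nothing is
lost, as tau is transcendental over k_0: this is the (2,3)-weighted degree.

In a filtration with values in N and leading coefficients in a finite extension of the
base field, the elements of degree <= n span a space of dimension O(n), whereas the
polynomials of weighted degree <= n form a space of dimension of order n^2.  Hence
deg_2 takes negative values, its value group is Z and Gr(B_2) = k_2[T, T^-1], while the
leading coefficients occurring in Gr(B_1) lie in no finite extension of k_1.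
*)

Set Implicit Arguments.
Unset Strict Implicit.
Unset Printing Implicit Defensive.

Import Order.TTheory GRing.Theory Num.Theory.
Local Open Scope ring_scope.

(** * Blowing up the initial form *)

Section BlowUp.
Variable L : fieldType.
Implicit Types (F G H : {poly {poly L}}) (p q : {poly L}) (b : L).

Definition shiftp b F : {poly {poly L}} := map_poly (comp_poly ('X + b%:P)) F.

Definition blow_coef : {rmorphism {poly L} -> {poly {poly L}}} :=
  horner_eval ('X * ('X)%:P : {poly {poly L}})
  \o map_poly (polyC \o polyC : {rmorphism L -> {poly {poly L}}}).

(* In {poly {poly L}} the outer variable is t and the inner one is Z; [blow] is
   Z |-> t Z and [psi b] is Z |-> b + t Z. *)
Definition blow : {rmorphism {poly {poly L}} -> {poly {poly L}}} :=
  horner_eval ('X : {poly {poly L}}) \o map_poly blow_coef.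

Definition psi b F := blow (shiftp b F).

Lemma blowX : blow 'X = 'X.
Proof. by rewrite /= map_polyX horner_evalE hornerX. Qed.

Lemma psiD b : {morph psi b : F G / F + G}.
Proof. by move=> F G; rewrite /psi /shiftp !rmorphD. Qed.

Lemma psiM b : {morph psi b : F G / F * G}.
Proof. by move=> F G; rewrite /psi /shiftp !rmorphM. Qed.

Lemma psiXn b k : psi b 'X^k = 'X^k.
Proof. by rewrite /psi /shiftp map_polyXn rmorphXn blowX. Qed.

Lemma coef_blowC p k j : (blow p%:P)`_k`_j = if j == k then p`_j else 0.
Proof.
elim/poly_ind: p k j => [|p c IH] k j.
  by rewrite polyC0 rmorph0 !coef0 if_same.
rewrite polyCD polyCM rmorphD rmorphM.
have -> : blow ('X)%:P = 'X * ('X)%:P.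
  by rewrite /= map_polyC horner_evalE hornerC /= map_polyX horner_evalE hornerX.
have -> : blow c%:P%:P = c%:P%:P by rewrite /= map_polyC horner_evalE hornerC /= map_polyC
  horner_evalE hornerC.
rewrite coefD mulrA coefMC !coefMX !coefD !coefC !coefMX.
move: IH; set B := blow p%:P => IH.
case: k j => [|k] [|j];
  rewrite ?eqSS ?IH ?coefC /= ?mul0r ?coef0 ?coefMX ?coef0 ?add0r ?addr0 ?coefC //.
by rewrite if_same.
Qed.

(** The monomial t^i Z^j is sent to t^(i+j) Z^j. *)
Lemma coef_blow F k j : (blow F)`_k`_j = if (j <= k)%N then F`_(k - j)`_j else 0.
Proof.
elim/poly_ind: F k j => [|F p IH] k j.
  by rewrite rmorph0 !coef0 if_same.
rewrite rmorphD rmorphM blowX coefD coefMX !coefD coef_blowC.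
move: IH; set B := blow F => IH; case: k => [|k] /=.
  case: j => [|j]; rewrite coef0 add0r //= coefMX subn0 coefC /= ?coef0 ?add0r //.
  by rewrite coefC.
rewrite IH; case: (ltngtP j k.+1) => hj.
- by rewrite -ltnS hj subSn // coefMX coefC /= ?coef0 addr0.
- by rewrite leqNgt ltnW // addr0.
- by rewrite hj ltnn subnn coefMX /= coef0 !add0r coefC.
Qed.

Lemma coef0_psi b F : (psi b F)`_0 = (F`_0).[b]%:P.
Proof.
apply/polyP => j; rewrite coef_blow leqn0 coefC; case: eqP => // ->.
by rewrite subn0 coef_map /= -horner_coef0 horner_comp !hornerE.
Qed.

Lemma coef_psi b F k j :
  (psi b F)`_k`_j = if (j <= k)%N then (F`_(k - j) \Po ('X + b%:P))`_j else 0.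
Proof. by rewrite coef_blow coef_map. Qed.

Lemma lowest_term F : F != 0 -> exists o H, F = 'X^o * H /\ H`_0 != 0.
Proof.
move=> F0; have hF : exists i, F`_i != 0.
  by exists (size F).-1; rewrite -[_`_ _]/(lead_coef F) lead_coef_eq0.
case: (ex_minnP hF) => o ho hmin.
exists o, (drop_poly o F); split; last by rewrite coef_drop_poly add0n.
rewrite -[LHS](poly_take_drop o) mulrC [take_poly _ _](_ : _ = 0) ?add0r //.
apply/polyP => i; rewrite coef_take_poly coef0; case: ifP => // io.
by apply/eqP; apply: contraTT io => /hmin; rewrite -leqNgt.
Qed.

(* m is the multiplicity of b as a root of H`_0. *)
Lemma psi_lowest b H : H`_0 != 0 ->
  exists (m k : nat) (G : {poly {poly L}}), [/\ ('X - b%:P) ^+ m %| H`_0,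
     psi b H = 'X^k * G, G`_0 != 0, (k <= m)%N & (size (G`_0)%R <= m.+1)%N].
Proof.
set p := H`_0 => p0; set q := p \Po ('X + b%:P).
have qK : q \Po ('X - b%:P) = p by rewrite -comp_polyA comp_polyD comp_polyX comp_polyC subrK
  comp_polyXr.
have q0 : q != 0 by apply: contraNneq p0 => q0; rewrite -qK q0 comp_poly0.
have hq : exists i, q`_i != 0.
  by exists (size q).-1; rewrite -[_`_ _]/(lead_coef q) lead_coef_eq0.
case: (ex_minnP hq) => m hm hmin.
(* The lowest term q_m Z^m of H_0(Z + b) becomes q_m t^m Z^m, and no other term of H contributes to
   it; hence [psi b H] has order at most m in t. *)
have hmm : (psi b H)`_m`_m = q`_m by rewrite coef_psi leqnn subnn.
have psi0 : psi b H != 0.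
  by apply: contraNneq hm => e; rewrite -hmm e !coef0.
have [k [G [eG G0]]] := lowest_term psi0.
have km : (k <= m)%N.
  rewrite leqNgt; apply: contra hm => mk.
  by rewrite -hmm eG mulrC coefMXn mk coef0.
exists m, k, G; split=> //.
- rewrite -qK; have -> : q = drop_poly m q * 'X^m.
    rewrite -[LHS](poly_take_drop m) [take_poly _ _](_ : _ = 0) ?add0r //.
    apply/polyP => i; rewrite coef_take_poly coef0; case: ifP => // io.
    by apply/eqP; apply: contraTT io => /hmin; rewrite -leqNgt.
  by rewrite rmorphM rmorphXn /= comp_polyX dvdp_mull.
(* After the substitution Z occurs only through t Z, so the coefficient of t^k has degree at most k
   in Z. *)
- apply/leq_sizeP => j mj.
  have := coef_psi b H k j; rewrite eG mulrC coefMXn ltnn subnn => ->.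
  by rewrite leqNgt (leq_ltn_trans km mj).
Qed.

(** * Multiplicity of roots lying outside a subfield *)

Section Halving.
Variable K : divringClosed L.

Lemma polyOver_psi b F : b \in K -> F \is a polyOver (polyOver K) ->
  psi b F \is a polyOver (polyOver K).
Proof.
move=> bK /polyOverP FK; apply/polyOverP => k; apply/polyOverP => j.
rewrite coef_psi; case: ifP => _; last exact: rpred0.
apply/polyOverP; apply: polyOver_comp => //.
by apply: rpredD; rewrite ?polyOverX ?polyOverC.
Qed.

(** Division by X^2 - b^2 over K leaves a remainder c X + d over K; from c b + d = 0 with b outside
    K follows c = d = 0. *)
Lemma quadratic_root_factor b p : b ^+ 2 \in K -> b \notin K ->
  p \is a polyOver K -> root p b ->
  exists2 s, s \is a polyOver K & p = s * ('X^2 - (b ^+ 2)%:P).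
Proof.
move=> b2K bK pK pb.
have [s [c [d [sK cK dK ep]]]] : exists s c d, [/\ s \is a polyOver K, c \in K,
    d \in K & p = s * ('X^2 - (b ^+ 2)%:P) + c *: 'X + d%:P]; last first.
  move: pb; rewrite {}ep /root !hornerE subrr mulr0 add0r.
  have [->|c0] := eqVneq c 0.
    by rewrite mul0r add0r => /eqP->; exists s; rewrite ?scale0r ?addr0.
  rewrite addr_eq0 => /eqP e; case/negP: bK.
  have -> : b = - d / c by rewrite -e mulrC mulKf.
  by rewrite rpred_div ?rpredN.
elim/poly_ind: p pK {pb} => [|p e IH] pK.
  by exists 0, 0, 0; rewrite !rpred0 mul0r scale0r !addr0.
have eK : e \in K by have /polyOverP/(_ 0%N) := pK; rewrite coefD coefMX coefC add0r.
have pK' : p \is a polyOver K.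
  by apply/polyOverP => i; have /polyOverP/(_ i.+1) := pK; rewrite coefD coefMX coefC addr0.
have [s [c [d [sK cK dK ->]]]] := IH pK'.
exists (s * 'X + c%:P), d, (c * b ^+ 2 + e); split=> //.
- by rewrite rpredD ?rpredM ?polyOverX ?polyOverC.
- by apply: rpredD => //; apply: rpredM.
- by rewrite -!mul_polyC polyCD polyCM; ring.
Qed.

(* A root outside K of a polynomial over K comes with its conjugate. *)
Lemma quadratic_root_mult b p m : (2%:R : L) != 0 -> b ^+ 2 \in K -> b \notin K ->
  p \is a polyOver K -> p != 0 -> ('X - b%:P) ^+ m %| p -> (m.*2 < size p)%N.
Proof.
move=> two0 b2K bK; elim: m p => [|m IH] p pK p0.
  by rewrite size_poly_gt0.
move=> hm; have pb : root p b.
  by rewrite -dvdp_XsubCl; apply: dvdp_trans hm; rewrite exprS dvdp_mulr.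
have [s sK ep] := quadratic_root_factor b2K bK pK pb.
have fE : 'X^2 - (b ^+ 2)%:P = ('X - b%:P) * ('X - (- b)%:P).
  by rewrite polyCN rmorphXn /=; ring.
have b0 : b != 0 by apply: contraNneq bK => ->; rewrite rpred0.
(* Since b differs from -b, the other m factors X - b divide the cofactor s; each factor X - b thus
   accounts for two degrees of p. *)
have cop : coprimep (('X - b%:P) ^+ m) ('X - (- b)%:P).
  apply: coprimep_expl; rewrite coprimep_XsubC root_XsubC.
  by rewrite eq_sym -addr_eq0 -mulr2n -mulr_natl mulf_neq0.
have s0 : s != 0 by apply: contraNneq p0 => s0; rewrite ep s0 mul0r.
have : ('X - b%:P) ^+ m %| s.
  rewrite -(Gauss_dvdpl _ cop) -(dvdp_mul2l _ _ (negbT (polyXsubC_eq0 b))).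
  move: hm; rewrite ep fE exprS mulrCA; exact.
move/(IH _ sK s0) => hs.
rewrite ep size_Mmonic ?monicXnsubC // size_XnsubC //.
by move: hs; case: (size s) => // ? ?; lia.
Qed.

End Halving.
End BlowUp.

(** * Weights of monomials and reversal of polynomials in u *)

Definition wt (m : 'X_{1..2}) : nat := (2 * m 0%R + 3 * m 1%R)%N.

Lemma wtD m m' : wt (m + m') = (wt m + wt m')%N.
Proof. by rewrite /wt !mnmDE; lia. Qed.

Lemma wt_inj m m' : wt m = wt m' -> m 1 = m' 1 -> m = m'.
Proof.
rewrite /wt => e e1; apply/mnmP => i; have [->|->] : i = 0 \/ i = 1.
- by case: i => [[|[|]]] // hi; [left|right]; apply: val_inj.
- by lia.
- exact: e1.
Qed.

Section Reversal.
Variable R : comNzRingType.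
Implicit Types F G : {poly R}.

(* u^-M G(u) as a polynomial in 1/u, provided [size G <= M.+1] *)
Definition revp M G : {poly R} := \poly_(k < M.+1) G`_(M - k).

Lemma revpD M : {morph revp M : F G / F + G}.
Proof.
by move=> F G; apply/polyP => k; rewrite coefD !coef_poly coefD; case: ifP; rewrite ?addr0.
Qed.

Lemma revpZ M c G : revp M (c%:P * G) = c%:P * revp M G.
Proof.
by apply/polyP => k; rewrite coefCM !coef_poly coefCM; case: ifP; rewrite ?mulr0.
Qed.

Lemma revp_mulX M G : revp M.+1 (G * 'X) = revp M G.
Proof.
apply/polyP => k; rewrite !coef_poly coefMX subn_eq0 !ltnS.
case: (leqP k M) => hk; first by rewrite leqW // subSn.
by rewrite if_same.
Qed.

Lemma revp_shift M k G : (size G <= M.+1)%N -> revp (M + k) G = 'X^k * revp M G.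
Proof.
move=> hG; apply/polyP => i; rewrite coefXnM !coef_poly ltnS.
case: (ltnP i k) => hi.
  by case: ifP => // _; apply: nth_default; apply: leq_trans hG _; lia.
have -> : (i <= M + k)%N = (i - k < M.+1)%N by lia.
by congr (if _ then G`__ else _); lia.
Qed.

(** Under these bounds nothing is truncated, and u^-(M + M') F G is the product of u^-M F and u^-M'
    G. *)
Lemma revpM M M' F G : (size F <= M.+1)%N -> (size G <= M'.+1)%N ->
  revp (M + M') (F * G) = revp M F * revp M' G.
Proof.
move=> hF hG; elim: M F hF => [|M IH] F hF.
  have -> : F = (F`_0)%:P by apply: size1_polyC.
  by rewrite add0n revpZ; congr (_ * _); apply/polyP=> i; rewrite coef_poly !coefC; case: i.
elim/poly_ind: F hF => [|F c _] hF.
  have r0 N : revp N 0 = 0 by apply/polyP => i; rewrite coef_poly !coef0 if_same.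
  by rewrite mul0r !r0 mul0r.
have hF' : (size F <= M.+1)%N.
  by move: hF; rewrite size_MXaddC; case: ifP => [/andP[/eqP-> _]|_]; rewrite ?size_poly0.
rewrite mulrDl mulrAC !revpD mulrDl addSn !revp_mulX IH //; congr (_ + _).
rewrite -addSn revpZ addnC revp_shift // mulrA; congr (_ * _).
apply/polyP => i; rewrite coefCM coefXn coef_poly coefC subn_eq0 ltnS.
by case: (ltngtP i M.+1) => _; rewrite /= ?mulr0 ?mulr1.
Qed.

End Reversal.

Section LowestTerms.
Variable L : fieldType.

Lemma lowest_term_unique (G H : {poly {poly L}}) a b :
  'X^a * G = 'X^b * H -> G`_0 != 0 -> H`_0 != 0 -> a = b /\ G = H.
Proof.
move=> e G0 H0; suff ab : a = b.
  by split=> //; move: e; rewrite ab; apply: mulfI; rewrite expf_neq0 ?polyX_eq0.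
wlog ab : a b G H e G0 H0 / (a <= b)%N.
  by move=> W; case: (leqP a b) => [|/ltnW] h; [apply: W e _ _ h|apply/esym;
    apply: W (esym e) _ _ h].
have := congr1 (fun F : {poly {poly L}} => F`_a) e.
rewrite !coefXnM ltnn subnn.
by case: ltngtP ab => // ab _ e0; rewrite e0 eqxx in G0.
Qed.

End LowestTerms.

(** * Degree and leading coefficient along the series *)

Section Lead.
Variables (L : fieldType) (beta : nat -> L).
Local Notation B := {mpoly L[2]}.
Implicit Types (x y : B) (c : L) (d : int).

(* f |-> f(u^2, u^3 Z), a polynomial in u over L[Z] *)
Definition eps : {rmorphism B -> {poly {poly L}}} :=
  mmap (polyC \o polyC : {rmorphism L -> {poly {poly L}}})
    (fun i : 'I_2 => if i == 0 then 'X^2 else 'X^3 * ('X)%:P).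

Lemma epsC c : eps c%:MP = c%:P%:P.
Proof. by rewrite /= mmapC. Qed.

Lemma epsXm m : eps 'X_[m] = ('X^(m 1))%:P * 'X^(wt m).
Proof.
rewrite /= mmapX /mmap1 !big_ord_recl big_ord0 mulr1.
have -> : lift ord0 ord0 = 1 :> 'I_2 by apply: val_inj.
rewrite [LHS](_ : _ = ('X^2) ^+ m 0 * ('X^3 * ('X)%:P) ^+ m 1 :> {poly {poly L}}) //.
rewrite /wt -exprM exprMn -exprM -rmorphXn /= mulrA -exprD mulrC.
by congr (_ * 'X^_).
Qed.

Lemma coef_eps x w j :
  (eps x)`_w`_j = \sum_(m <- msupp x) x@_m *+ ((m 1 == j) && (wt m == w)).
Proof.
rewrite {1}(mpolyE x) rmorph_sum /= !coef_sum; apply: eq_bigr => m _.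
rewrite -mul_mpolyC rmorphM -/(eps _) -/(eps _) epsC epsXm mulrA -polyCM.
rewrite coefCM coefXn mul_polyC eq_sym; case: eqP => _.
  by rewrite mulr1 coefZ coefXn eq_sym andbT mulr_natr.
by rewrite mulr0 coef0 andbF.
Qed.

Lemma coef_eps_wt x m : (eps x)`_(wt m)`_(m 1) = x@_m.
Proof.
rewrite coef_eps; have [hm|hm] := boolP (m \in msupp x).
  rewrite (bigD1_seq m) ?msupp_uniq //= !eqxx big1 ?addr0 // => m' mm'.
  by case: andP => // -[/eqP e1 /eqP e2]; rewrite (wt_inj e2 e1) eqxx in mm'.
rewrite (memN_msupp_eq0 hm) big_seq big1 // => m' hm'.
by case: andP => // -[/eqP e1 /eqP e2]; rewrite -(wt_inj e2 e1) hm' in hm.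
Qed.

Lemma coef_epsP x w j : (eps x)`_w`_j != 0 ->
  exists m : 'X_{1..2}, [/\ wt m = w, m 1 = j & (eps x)`_w`_j = x@_m].
Proof.
move=> h; have [[m /andP[/eqP e1 /eqP e2]]|hN] := pselect (exists m : 'X_{1..2}, (m 1 == j) &&
  (wt m == w)).
  by exists m; split=> //; rewrite -e1 -e2 coef_eps_wt.
case/negP: h; rewrite coef_eps big1 // => m _.
by case hm: (_ && _); rewrite ?mulr0n //; case: hN; exists m.
Qed.

Lemma eps_inj : injective eps.
Proof. by move=> x y e; apply/mpolyP => m; rewrite -!coef_eps_wt e. Qed.

(* Substitutes beta_0 + beta_1 t + ... + beta_(n-1) t^(n-1) + t^n Z for Z; t is 1/u. *)
Fixpoint Psi n F : {poly {poly L}} := if n is n'.+1 then psi (beta n') (Psi n' F) else F.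

Lemma PsiD n : {morph Psi n : F G / F + G}.
Proof. by elim: n => //= n IH F G; rewrite IH psiD. Qed.

Lemma PsiM n : {morph Psi n : F G / F * G}.
Proof. by elim: n => //= n IH F G; rewrite IH psiM. Qed.

Lemma PsiXn n k : Psi n 'X^k = 'X^k.
Proof. by elim: n => //= n ->; rewrite psiXn. Qed.

(* x is a series in 1/u with no term above degree d, and c as coefficient of degree d. *)
Definition lead d x c : Prop := exists (M n o : nat) (H : {poly {poly L}}),
  [/\ (size (eps x) <= M.+1)%N, Psi n (revp M (eps x)) = 'X^o * H,
      H`_0 = c%:P & d = M%:Z - o%:Z].

(** Raising M multiplies by a power of t, and a lowest coefficient free of Z is not affected by
    further terms of the series. Two instances of [lead] can therefore be compared with the same M
    and n. *)
Lemma lead_raise d x c : lead d x c -> exists M0 n0 : nat, forall M n,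
  (M0 <= M)%N -> (n0 <= n)%N -> exists (o : nat) (H : {poly {poly L}}),
  [/\ (size (eps x) <= M.+1)%N, Psi n (revp M (eps x)) = 'X^o * H,
      H`_0 = c%:P & d = M%:Z - o%:Z].
Proof.
case=> M [n [o [H [hM e H0 ->]]]]; exists M, n => M' n' hM' hn'.
rewrite -(subnKC hM') -(subnKC hn'); move: (M' - M)%N (n' - n)%N => {hM' hn' M' n'} k l.
exists (k + o)%N; rewrite revp_shift //.
suff [G [eG G0]] : exists G : {poly {poly L}}, Psi (n + l) (revp M (eps x)) = 'X^o * G /\ G`_0 =
  c%:P.
  by exists G; split=> //; [lia|rewrite PsiM PsiXn eG mulrA exprD|lia].
elim: l => [|l [G [eG G0]]]; first by exists H; rewrite addn0.
exists (psi (beta (n + l)) G); rewrite addnS /= eG psiM psiXn; split=> //.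
by rewrite coef0_psi G0 hornerC.
Qed.

Lemma lead_unique d x c c' : lead d x c -> lead d x c' -> c = c'.
Proof.
move=> /lead_raise[M [n h]] /lead_raise[M' [n' h']].
have [o [H [_ e H0 ed]]] := h _ _ (leq_maxl M M') (leq_maxl n n').
have [o' [H' [_ e' H0' ee]]] := h' _ _ (leq_maxr M M') (leq_maxr n n').
have eo : o = o' by lia.
have : 'X^o * H = 'X^o * H' by rewrite -e e' eo.
by move/(mulfI (expf_neq0 _ (negbT (polyX_eq0 _)))) => e2; apply: polyC_inj; rewrite -H0 e2.
Qed.

Lemma leadD d x y c c' : lead d x c -> lead d y c' -> lead d (x + y) (c + c').
Proof.
move=> /lead_raise[M [n h]] /lead_raise[M' [n' h']].
have [o [H [hM e H0 ed]]] := h _ _ (leq_maxl M M') (leq_maxl n n').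
have [o' [H' [hM' e' H0' ee]]] := h' _ _ (leq_maxr M M') (leq_maxr n n').
have eo : o = o' by lia.
exists (maxn M M'), (maxn n n'), o, (H + H'); split=> //.
- rewrite rmorphD; apply: leq_trans (size_polyD _ _) _.
  by rewrite geq_max hM hM'.
- by rewrite rmorphD revpD PsiD e e' -eo mulrDr.
- by rewrite coefD H0 H0' polyCD.
Qed.

Lemma leadM d d' x y c c' : lead d x c -> lead d' y c' -> lead (d + d') (x * y) (c * c').
Proof.
move=> /lead_raise[M [n h]] /lead_raise[M' [n' h']].
have [o [H [hM e H0 ->]]] := h _ _ (leqnn M) (leq_maxl n n').
have [o' [H' [hM' e' H0' ->]]] := h' _ _ (leqnn M') (leq_maxr n n').
exists (M + M')%N, (maxn n n'), (o + o')%N, (H * H'); split.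
- rewrite rmorphM; apply: leq_trans (size_polyMleq _ _) _; lia.
- by rewrite rmorphM revpM // PsiM e e' exprD mulrACA.
- by rewrite coef0M H0 H0' polyCM.
- by lia.
Qed.

Lemma lead_lt d d' x c : lead d x c -> d < d' -> lead d' x 0.
Proof.
move=> [M [n [o [H [hM e H0 ->]]]]] hd.
have [k ek] : exists k : nat, d' = (M + k.+1)%:Z - o%:Z.
  by exists (absz (d' - (M%:Z - o%:Z))%R).-1; lia.
exists (M + k.+1)%N, n, o, ('X^(k.+1) * H); split=> //.
- by apply: leq_trans hM _; lia.
- by rewrite revp_shift // PsiM PsiXn e mulrCA.
- by rewrite coef0M coefXn mul0r polyC0.
Qed.

(** When the coefficient in degree d vanishes, one power of t splits off. The next coefficient may
    still involve Z, and one more substitution replaces it by its value at [beta n]. *)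
Lemma lead_pred d x : lead d x 0 -> exists c, lead (d - 1) x c.
Proof.
move=> [M [n [o [H [hM e H0 ->]]]]].
have eH : H = 'X^1 * drop_poly 1 H.
  rewrite -[LHS](poly_take_drop 1) mulrC [take_poly _ _](_ : _ = 0) ?add0r //.
  apply/polyP => i; rewrite coef_take_poly coef0; case: ifP => //.
  by case: i => // _; rewrite H0 polyC0.
exists ((drop_poly 1 H)`_0).[beta n], M, n.+1, o.+1, (psi (beta n) (drop_poly 1 H)); split=> //.
- by rewrite /= e psiM psiXn {1}eH psiM psiXn mulrA -exprD addn1.
- by rewrite coef0_psi.
- by lia.
Qed.

Lemma leadC c : lead 0 c%:MP c.
Proof.
exists 0%N, 0%N, 0%N, c%:P%:P; split=> //.
- by rewrite epsC; apply: size_polyC_leq1.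
- rewrite epsC mul1r /=; apply/polyP => i.
  by rewrite coef_poly !coefC; case: i.
- by rewrite coefC.
Qed.

Lemma leadX : lead 2 'X_0 1.
Proof.
have e : eps 'X_0 = 'X^2.
  by rewrite epsXm /wt !mnmE /= expr0 mul1r.
exists 2%N, 0%N, 0%N, 1; split=> //; rewrite ?e.
- by rewrite size_polyXn.
- rewrite mul1r /=; apply/polyP => i; rewrite coef_poly !coefXn coefC.
  by case: i => [|[|[|i]]].
- by rewrite coefC.
Qed.

Lemma leadY : lead 3 'X_1 (beta 0).
Proof.
have e : eps 'X_1 = ('X)%:P * 'X^3.
  by rewrite epsXm /wt !mnmE /=.
have er : revp 3 (eps 'X_1) = ('X)%:P.
  rewrite e revpZ (_ : revp _ _ = 1) ?mulr1 //.
  apply/polyP => i; rewrite coef_poly !coefXn coefC.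
  by case: i => [|[|[|[|i]]]].
exists 3%N, 1%N, 0%N, (psi (beta 0) ('X)%:P); split=> //.
- rewrite e; apply: leq_trans (size_polyMleq _ _) _.
  by rewrite size_polyXn addnS -[4%N]/(1 + 3)%N leq_add2r size_polyC_leq1.
- by rewrite /= er mul1r.
- by rewrite coef0_psi coefC hornerX.
Qed.

(** At a level where the lowest coefficient of x y is free of Z, it is the product of the lowest
    coefficients of x and y, which are polynomials in Z; a non-zero constant has only constant
    factors. *)
Lemma lead_factor d x y c : c != 0 -> lead d (x * y) c ->
  exists d' c', c' != 0 /\ lead d' x c'.
Proof.
move=> c0 /lead_raise[M0 [n h]].
pose Mx := (size (eps x) + M0)%N; pose My := size (eps y).
have [o [H [hM e H0 ed]]] := h (Mx + My)%N n ltac:(lia) (leqnn n).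
have hx : (size (eps x) <= Mx.+1)%N by rewrite /Mx; lia.
have hy : (size (eps y) <= My.+1)%N by rewrite /My; lia.
move: e; rewrite rmorphM revpM // PsiM => e.
have H00 : H`_0 != 0 by rewrite H0 polyC_eq0.
have : Psi n (revp Mx (eps x)) * Psi n (revp My (eps y)) != 0.
  rewrite e mulf_neq0 ?expf_neq0 ?polyX_eq0 //.
  by apply: contraNneq H00 => ->; rewrite coef0.
rewrite mulf_eq0 negb_or => /andP[nx ny].
have [ox [Hx [ex Hx0]]] := lowest_term nx.
have [oy [Hy [ey Hy0]]] := lowest_term ny.
have [_ eH] : (ox + oy)%N = o /\ Hx * Hy = H.
  apply: lowest_term_unique => //; last by rewrite coef0M mulf_neq0.
  by rewrite exprD mulrACA -ex -ey.
have : size (Hx`_0 * Hy`_0) == 1%N.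
  by rewrite -coef0M eH H0 size_polyC c0.
rewrite size_mul_eq1 => /andP[/eqP hx1 _].
have eC : Hx`_0 = (Hx`_0`_0)%:P by apply: size1_polyC; rewrite hx1.
exists (Mx%:Z - ox%:Z), Hx`_0`_0; split.
  by move: Hx0; rewrite eC polyC_eq0 coefC.
by exists Mx, n, ox, Hx.
Qed.

(** * Termination of the process over the base of the tower *)

Section Tower.
Variable K : nat -> divringClosed L.
Hypothesis two0 : (2%:R : L) != 0.
Hypothesis K_sub : forall n, {subset K n <= K n.+1}.
Hypothesis betaK : forall n, beta n \in K n.+1.
Hypothesis betaN : forall n, beta n.+1 \notin K n.+1.
Hypothesis betaK2 : forall n, beta n.+1 ^+ 2 \in K n.+1.

Lemma polyOver_K_sub n F : F \is a polyOver (polyOver (K n)) ->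
  F \is a polyOver (polyOver (K n.+1)).
Proof.
move=> /polyOverP h; apply/polyOverP => i; apply/polyOverP => j.
by apply: K_sub; have /polyOverP := h i.
Qed.

Lemma polyOver_Xn_mul (S : divringClosed L) k (G : {poly {poly L}}) :
  'X^k * G \is a polyOver (polyOver S) -> G \is a polyOver (polyOver S).
Proof.
move=> /polyOverP h; apply/polyOverP => i.
by have := h (i + k)%N; rewrite coefXnM ltnNge leq_addl addnK.
Qed.

(** The invariant says that the current degree M - o is at least deg H_0. If [beta n.+1] has
    multiplicity m in H_0, then deg H_0 is at least 2m, while a step lowers the degree by at most m
    and leaves a polynomial of degree at most m. The invariant persists and deg H_0 falls until it
    is 0, with M - o still non-negative. *)
Lemma lead_exists_descent s n o M x (H : {poly {poly L}}) : (size (H`_0)%R <= s)%N ->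
  (size (eps x) <= M.+1)%N -> Psi n.+1 (revp M (eps x)) = 'X^o * H ->
  H \is a polyOver (polyOver (K n.+1)) -> H`_0 != 0 ->
  (o + (size (H`_0)%R).-1 <= M)%N ->
  exists (d : nat) c, c != 0 /\ lead d%:Z x c.
Proof.
elim: s n o H => [|s IH] n o H hs hM e HK H0 ho.
  by move: hs; rewrite leqNgt size_poly_gt0 H0.
have [h1|h1] := leqP (size H`_0) 1.
  have eC := size1_polyC h1.
  exists (M - o)%N, H`_0`_0; split; first by move: H0; rewrite eC polyC_eq0 coefC.
  by exists M, n.+1, o, H; split=> //; lia.
have [m [k [G [hm eG G0 km hG]]]] := psi_lowest (beta n.+1) H0.
have H0K : H`_0 \is a polyOver (K n.+1) by have /polyOverP := HK; apply.
have m2 := quadratic_root_mult two0 (betaK2 n) (betaN n) H0K H0 hm.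
apply: (IH n.+1 (o + k)%N G) => //.
- by move: hs hG m2 h1; lia.
- by rewrite [LHS]/= -/(Psi n.+1 _) e psiM psiXn eG mulrA exprD.
- apply: (@polyOver_Xn_mul _ k); rewrite -eG; apply: polyOver_psi => //.
  exact: polyOver_K_sub.
- by move: hG m2 h1 km ho; lia.
Qed.

Lemma lead_exists_K x : (forall m, x@_m \in K 0%N) -> x != 0 ->
  exists (d : nat) c, c != 0 /\ lead d%:Z x c.
Proof.
move=> xK x0.
have e0 : eps x != 0 by rewrite -(rmorph0 eps) (inj_eq eps_inj).
pose M := (size (eps x)).-1; pose H := revp M (eps x).
have hM : (size (eps x) <= M.+1)%N by rewrite /M; lia.
have eH0 : H`_0 = lead_coef (eps x) by rewrite coef_poly subn0.
have H0 : H`_0 != 0 by rewrite eH0 lead_coef_eq0.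
have HK : H \is a polyOver (polyOver (K 0%N)).
  apply/polyOverP => i; apply/polyOverP => j; rewrite coef_poly.
  case: ifP => _; last by rewrite coef0 rpred0.
  have [->|/coef_epsP[m [_ _ ->]]] := eqVneq (eps x)`_(M - i)`_j 0; [exact: rpred0|exact: xK].
(* No conjugate is available for [beta 0]: the first substitution may lower the degree by deg H_0
   and leave a polynomial of that same degree. A monomial of weight M has Y-exponent at most M/3,
   which leaves enough room for both. *)
have h3 : (3 * (size (H`_0)%R).-1 <= M)%N.
  have : (eps x)`_M`_(size H`_0).-1 != 0.
    by rewrite -[_`_M]/(lead_coef (eps x)) -eH0 -[_`_ _]/(lead_coef H`_0) lead_coef_eq0.
  by case/coef_epsP => m [<- <- _]; rewrite /wt leq_addl.
have [m [k [G [hm eG G0 km hG]]]] := psi_lowest (beta 0) H0.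
have m1 : (m < size (H`_0)%R)%N.
  by have := dvdp_leq H0 hm; rewrite size_exp_XsubC.
apply: (@lead_exists_descent (size G`_0) 0 k M x G) => //.
- apply: (@polyOver_Xn_mul _ k); rewrite -eG; apply: polyOver_psi => //.
  exact: polyOver_K_sub.
- by move: hG m1 km h3; lia.
Qed.

End Tower.
End Lead.

(** * Finite extensions and towers of square roots *)

Section FiniteSpan.
Variables (k L : fieldType) (iota : {rmorphism k -> L}).
Implicit Types (e : seq L) (x y : L).

Definition inspan e x : Prop :=
  exists a : nat -> k, x = \sum_(i < size e) iota (a i) * e`_i.

Lemma inspanD e x y : inspan e x -> inspan e y -> inspan e (x + y).
Proof.
move=> [a ->] [b ->]; exists (fun i => a i + b i).
by rewrite -big_split; apply: eq_bigr => i _; rewrite /= rmorphD mulrDl.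
Qed.

Lemma inspanZ e c x : inspan e x -> inspan e (iota c * x).
Proof.
move=> [a ->]; exists (fun i => c * a i).
by rewrite mulr_sumr; apply: eq_bigr => i _; rewrite rmorphM mulrA.
Qed.

Lemma inspan0 e : inspan e 0.
Proof. by exists (fun=> 0); rewrite big1 // => i _; rewrite rmorph0 mul0r. Qed.

Lemma inspanN e x : inspan e x -> inspan e (- x).
Proof. by move=> /(inspanZ (-1)); rewrite rmorphN1 mulN1r. Qed.

Lemma inspan_mem e x : x \in e -> inspan e x.
Proof.
move=> xe; exists (fun i => (i == index x e)%:R).
have hi : (index x e < size e)%N by rewrite index_mem.
rewrite (bigD1 (Ordinal hi)) //= eqxx rmorph1 mul1r nth_index // big1 ?addr0 //.
by move=> i; rewrite -val_eqE /= => /negbTE->; rewrite rmorph0 mul0r.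
Qed.

Lemma inspan_ind e (P : L -> Prop) : P 0 -> (forall x y, P x -> P y -> P (x + y)) ->
  (forall c x, P x -> P (iota c * x)) -> (forall x, x \in e -> P x) ->
  forall x, inspan e x -> P x.
Proof.
move=> P0 PD PZ Pe x [a ->]; elim/big_ind: _ => // i _.
by apply/PZ/Pe/mem_nth.
Qed.

Definition span_subring e : Prop :=
  inspan e 1 /\ forall x y, inspan e x -> inspan e y -> inspan e (x * y).

Lemma inspan_horner e (p : {poly k}) x : span_subring e -> inspan e x ->
  inspan e (map_poly iota p).[x].
Proof.
move=> [e1 eM] ex; elim/poly_ind: p => [|p c IH].
  by rewrite rmorph0 horner0; apply: inspan0.
rewrite rmorphD rmorphM /= map_polyX map_polyC !hornerE.
by apply: inspanD; [apply: eM|rewrite -[X in inspan _ X]mulr1; apply: inspanZ].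
Qed.

(** A relation q(x) x + c = 0 with c non-zero gives x^-1 = - q(x) / c. *)
Lemma inspan_inv e x : span_subring e -> algebraicOver iota x ->
  inspan e x -> inspan e x^-1.
Proof.
move=> eR xalg ex; have [->|x0] := eqVneq x 0; first by rewrite invr0; apply: inspan0.
have [q [c [c0 hq]]] : exists (q : {poly k}) c, c != 0 /\ root (map_poly iota (q * 'X + c%:P)) x.
  case: xalg => p; elim/poly_ind: p => [|p c IH]; first by rewrite eqxx.
  have [->|c0] := eqVneq c 0; last by move=> _ h; exists p, c.
  rewrite addr0 => p0; rewrite rmorphM /= map_polyX rootM => /orP[h|].
    by apply: IH => //; apply: contraNneq p0 => ->; rewrite mul0r.
  by rewrite rootX (negbTE x0).
move: hq; rewrite /root rmorphD rmorphM /= map_polyX map_polyC !hornerE addr_eq0 => /eqP hq.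
have ic0 : iota c != 0 by rewrite fmorph_eq0.
have -> : x^-1 = iota (- c^-1) * (map_poly iota q).[x].
  apply: (mulIf x0); rewrite mulVf // -mulrA hq rmorphN fmorphV mulrNN mulVf //.
by apply: inspanZ; apply: inspan_horner.
Qed.

(** Algebraic elements are adjoined one at a time: if c satisfies a monic relation of degree n, the
    products a c^j with j < n suffice, as higher powers of c reduce by strong induction on the
    exponent. *)
Lemma finite_span_subring (s : seq L) : (forall x, x \in s -> algebraicOver iota x) ->
  exists e, span_subring e /\ forall x, x \in s -> inspan e x.
Proof.
elim: s => [|c s IH] halg.
  exists [:: 1]; split=> //; split; first by apply: inspan_mem; rewrite mem_head.
  have h x : inspan [:: 1] x -> exists a, x = iota a.
    by move=> [a ->]; exists (a 0%N); rewrite big_ord1 mulr1.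
  move=> x y /h[a ->] /h[b ->]; exists (fun=> a * b).
  by rewrite big_ord1 mulr1 rmorphM.
have [e [[e1 eM] es]] := IH (fun x xs => halg x (mem_behead (s := c :: s) xs)).
have [p pmon pc] := (integral_algebraic iota c).1 (halg c (mem_head _ _)).
pose n := (size p).-1.
have pn : size p = n.+1 by rewrite prednK // size_poly_gt0 monic_neq0.
have cn : c ^+ n = - \sum_(i < n) iota p`_i * c ^+ i.
  have lc : (map_poly iota p)`_n = 1.
    move: pmon; rewrite -(map_monic iota) => /monicP.
    by rewrite lead_coefE size_map_poly.
  move/eqP: pc; rewrite horner_coef size_map_poly pn big_ord_recr /= lc mul1r addrC => /eqP;
    rewrite addr_eq0 => /eqP->.
  by congr (- _); apply: eq_bigr => i _; rewrite coef_map.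
pose e' := [seq a * c ^+ j | a <- e, j <- seq.iota 0 n].
have h1 z j : inspan e z -> inspan e' (z * c ^+ j).
  move=> ze; have [m] := ubnP j; elim: m j => // m IHm j jm.
  have [jn|nj] := ltnP j n.
    clear IHm; move: z ze; apply: inspan_ind.
    - by rewrite mul0r; apply: inspan0.
    - by move=> x y hx hy; rewrite mulrDl; apply: inspanD.
    - by move=> a x hx; rewrite -mulrA; apply: inspanZ.
    - move=> a ae; apply: inspan_mem; apply/allpairsP; exists (a, j).
      by rewrite mem_iota.
  rewrite -(subnK nj) exprD cn mulrN mulrN; apply: inspanN.
  rewrite mulrA mulr_sumr; elim/big_ind: _ => [|x y|i _]; [exact: inspan0|exact: inspanD|].
  have -> : z * c ^+ (j - n) * (iota p`_i * c ^+ i) = iota p`_i * (z * c ^+ (j - n + i)).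
    by rewrite exprD; ring.
  by apply: inspanZ; apply: IHm; have := ltn_ord i; lia.
have n0 : (0 < n)%N.
  rewrite lt0n; apply: contraTneq pc => n0.
  have : size p == 1%N by rewrite pn n0.
  case/size_poly1P => d d0 ->.
  by rewrite map_polyC /root hornerC fmorph_eq0.
exists e'; split; last first.
  move=> x; rewrite inE => /orP[/eqP->|xs]; first by rewrite -[c]mul1r -[c in 1 * c]expr1;
    apply: h1.
  by rewrite -[x]mulr1 -(expr0 c); apply: h1; apply: es.
split; first by rewrite -[1]mulr1 -{2}(expr0 c); apply: h1.
move=> x y hx hy; move: x hx; apply: inspan_ind.
- by rewrite mul0r; apply: inspan0.
- by move=> x z h h'; rewrite mulrDl; apply: inspanD.
- by move=> a x h; rewrite -mulrA; apply: inspanZ.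
move=> _ /allpairsP[[a j] [/= ae _ ->]]; move: y hy; apply: inspan_ind.
- by rewrite mulr0; apply: inspan0.
- by move=> x z h h'; rewrite mulrDr; apply: inspanD.
- by move=> b x h; rewrite mulrCA; apply: inspanZ.
move=> _ /allpairsP[[b l] [/= be _ ->]].
by rewrite mulrACA -exprD; apply: h1; apply: eM; apply: inspan_mem.
Qed.

(** The coordinates form a matrix with more rows than columns, which has a non-zero vector in its
    left kernel. *)
Lemma inspan_dependent e m (x : 'I_m -> L) : (size e < m)%N ->
  (forall i, inspan e (x i)) ->
  exists2 v : 'I_m -> k, exists i, v i != 0 & \sum_i iota (v i) * x i = 0.
Proof.
move=> em /choice[a ha].
pose A := \matrix_(i < m, j < size e) a i j.
have : kermx A != 0.
  rewrite -mxrank_eq0 mxrank_ker -lt0n subn_gt0.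
  by apply: leq_ltn_trans em; apply: rank_leq_col.
case/rowV0Pn => v /sub_kermxP vA v0; exists (fun i => v 0 i).
  apply/existsP; apply: contraR v0; rewrite negb_exists => /forallP h.
  by apply/eqP/rowP => i; rewrite mxE; apply/eqP; move: (h i); rewrite negbK.
under eq_bigr do rewrite ha mulr_sumr.
rewrite exchange_big big1 // => j _.
have /rowP/(_ j) := vA; rewrite !mxE => /(congr1 iota); rewrite rmorph0 rmorph_sum => h.
transitivity ((\sum_i iota (v 0 i * A i j)) * e`_j); last by rewrite h mul0r.
by rewrite mulr_suml; apply: eq_bigr => i _; rewrite mxE rmorphM mulrA.
Qed.

End FiniteSpan.

(** * Subfields given by predicates *)

Section Closed.
Variables (k L : fieldType) (iota : {rmorphism k -> L}).

Lemma adjoin_intermediate A : intermediate_field iota (adjoin iota A).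
Proof.
split=> [c|x y hx hy|x y hx hy|x hx] S hS hA.
- exact: intermediate_base hS c.
- by apply: (intermediate_sub hS); [apply: hx|apply: hy].
- by apply: (intermediate_mul hS); [apply: hx|apply: hy].
- by apply: (intermediate_inv hS); apply: hx.
Qed.

(** The boolean form of an intermediate field, as [divringClosed] requires. *)
Definition field_pred S (h : intermediate_field iota S) : {pred L} := fun x => `[< S x >].

Lemma field_predP S (h : intermediate_field iota S) x : reflect (S x) (x \in field_pred h).
Proof. exact: asboolP. Qed.

Lemma field_pred_divring S (h : intermediate_field iota S) : divring_closed (field_pred h).
Proof.
split.
- by apply/field_predP; rewrite -(rmorph1 iota); apply: intermediate_base h _.
- by move=> x y /field_predP hx /field_predP hy; apply/field_predP; apply: (intermediate_sub h).
- move=> x y /field_predP hx /field_predP hy; apply/field_predP.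
  by apply: (intermediate_mul h) => //; apply: (intermediate_inv h).
Qed.

HB.instance Definition _ S (h : intermediate_field iota S) :=
  GRing.isDivringClosed.Build L (field_pred h) (field_pred_divring h).

End Closed.

Section SubField.
Variables (L : fieldType) (K : divringClosed L).
Definition subfield : Type := {x : L | x \in K}.
HB.instance Definition _ := SubChoice.on subfield.
HB.instance Definition _ := [SubChoice_isSubComUnitRing of subfield by <:].
HB.instance Definition _ := [SubComUnitRing_isSubIntegralDomain of subfield by <:].
HB.instance Definition _ := [SubIntegralDomain_isSubField of subfield by <:].
Definition subfield_val : {rmorphism subfield -> L} := val.
End SubField.

(** * Non-squares in finite extensions *)

Section Nonsquare.
Variables (F : fieldType) (L : closedFieldType) (j : {rmorphism F -> L}) (t : F).
Hypothesis t_nopow : forall (m e : nat) (b : F), (0 < e < m)%N -> b ^+ m != t ^+ e.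

(** Otherwise the gcd D of P and X^m - t has a degree d with 0 < d < m, and all its roots are m-th
    roots of t. Its normalized constant term b is the product of the opposites of these roots, so
    b^m = t^d, the sign disappearing because m is even; this contradicts [t_nopow]. *)
Lemma root_degree m s (P : {poly F}) : ~~ odd m -> s ^+ m = j t ->
  P != 0 -> (size P <= m)%N -> ~~ root (map_poly j P) s.
Proof.
move=> m_even sm P0 Pm; apply/negP => Ps.
have m0 : (0 < m)%N by apply: leq_trans Pm; rewrite size_poly_gt0.
pose Q : {poly F} := 'X^m - t%:P; pose D := gcdp P Q.
have Qs : map_poly j Q = 'X^m - (j t)%:P by rewrite rmorphB /= map_polyXn map_polyC.
have D0 : D != 0 by rewrite gcdp_eq0 negb_and P0.
have Ds : root (map_poly j D) s.
  by rewrite gcdp_map root_gcd Ps Qs /root !hornerE sm subrr.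
have sD : (1 < size D)%N.
  by rewrite -(size_map_poly j); apply: root_size_gt1 Ds; rewrite map_poly_eq0.
have sDm : (size D <= m)%N by apply: leq_trans Pm; apply: dvdp_leq => //; apply: dvdp_gcdl.
have [r er] := closed_field_poly_normal (map_poly j D).
have lc0 : lead_coef (map_poly j D) != 0 by rewrite lead_coef_eq0 map_poly_eq0.
have sr : size r = (size D).-1.
  have := congr1 (fun p : {poly L} => size p) er.
  by rewrite size_map_poly size_scale // size_prod_XsubC => ->.
have rz z : z \in r -> z ^+ m = j t.
  move=> zr; have : root (map_poly j D) z by rewrite er rootZ // root_prod_XsubC.
  by rewrite gcdp_map root_gcd Qs => /andP[_]; rewrite /root !hornerE subr_eq0 => /eqP.
pose b := D.[0] / lead_coef D.
have jb : j b = \prod_(z <- r) (- z).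
  have e0 : j D.[0] = lead_coef (map_poly j D) * \prod_(z <- r) (- z).
    rewrite -horner_map rmorph0 {1}er hornerZ horner_prod.
    by congr (_ * _); apply: eq_bigr => z _; rewrite !hornerE.
  by rewrite fmorph_div e0 -lead_coef_map mulrC mulKf.
have := t_nopow (m := m) (e := size r) b; rewrite sr -ltnS prednK ?sD; last by apply: ltnW.
move=> h; have /eqP := h sDm; apply; apply: (fmorph_inj j).
rewrite !rmorphXn /= jb -sr; elim: r rz {er sr jb h} => [|z r IH] rz.
  by rewrite big_nil expr1n.
rewrite big_cons exprMn IH => [|y yr]; last by rewrite rz // inE yr orbT.
by rewrite exprNn -signr_odd (negbTE m_even) mul1r rz ?mem_head // -exprS.
Qed.

(** If every element of K were a square, K would contain a 2^r-th root s of t with r =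
    [(size e).+1]. As 2^r exceeds [size e], the powers s^i with i < 2^r would be dependent over F,
    against [root_degree]. *)
Lemma exists_nonsquare (K : L -> Prop) e :
  (forall x, K x -> inspan j e x) -> K (j t) -> K 1 -> (forall x y, K x -> K y -> K (x * y)) ->
  exists2 a, K a & forall b, K b -> b ^+ 2 != a.
Proof.
move=> Ke Kt K1 KM; apply: contrapT => hN.
have sqrt a : K a -> exists2 b, K b & b ^+ 2 = a.
  move=> Ka; apply: contrapT => hb; apply: hN; exists a => // b Kb.
  by apply/eqP => eb; apply: hb; exists b.
have [s Ks es] : exists2 s, K s & s ^+ (2 ^ (size e).+1) = j t.
  elim: (size e).+1 => [|r [s Ks es]]; first by exists (j t).
  by have [u Ku eu] := sqrt s Ks; exists u => //; rewrite expnS exprM eu.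
set m := (2 ^ _)%N in es; have em : (size e < m)%N by apply: ltn_trans (ltnSn _) (ltn_expl _ _).
have KX i : K (s ^+ i) by elim: i => // i IH; rewrite exprS; apply: KM.
have [v [i vi] ev] := inspan_dependent em (fun i : 'I_m => Ke _ (KX i)).
pose P := \poly_(l < m) (if insub l is Some l' then v l' else 0).
have Pl (l : 'I_m) : P`_l = v l by rewrite coef_poly ltn_ord valK.
have P0 : P != 0 by apply: contraNneq vi => P0; rewrite -Pl P0 coef0.
have : ~~ root (map_poly j P) s.
  by apply: (root_degree (m := m)) => //; [rewrite /m expnS oddM|apply: size_poly].
case/negP; rewrite /root -[X in _ == X]ev; apply/eqP.
rewrite (@horner_coef_wide _ m); last by rewrite size_map_poly; apply: size_poly.
by apply: eq_bigr => l _; rewrite coef_map Pl.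
Qed.

End Nonsquare.

(** * A tower of quadratic extensions *)

Section QuadraticTower.
Variables (k1 F : fieldType) (k2 : closedFieldType).
Variables (i12 : {rmorphism k1 -> k2}) (iF : {rmorphism F -> k1}) (t : F).
Hypothesis t_nopow : forall (m e : nat) (b : F), (0 < e < m)%N -> b ^+ m != t ^+ e.
Hypothesis k1_finite : exists e, forall x, inspan iF e x.
Let iF2 : {rmorphism F -> k2} := i12 \o iF.

Lemma quadratic_extension (K : k2 -> Prop) (a : k2) : intermediate_field i12 K ->
  K (a ^+ 2) -> intermediate_field i12 (fun x => exists y z, [/\ K y, K z & x = y + z * a]).
Proof.
move=> hK Ka; have K0 : K 0 by rewrite -(rmorph0 i12); apply: intermediate_base hK _.
have KB := intermediate_sub hK; have KM := intermediate_mul hK.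
have KN x : K x -> K (- x) by move=> /(KB _ _ K0); rewrite sub0r.
have KD x y : K x -> K y -> K (x + y) by move=> hx /KN hy; rewrite -[y]opprK; apply: KB.
have KV := intermediate_inv hK.
split=> [c|_ _ [y [z [Ky Kz ->]]] [y' [z' [Ky' Kz' ->]]]|_ _ [y [z [Ky Kz ->]]] [y' [z' [Ky' Kz'
  ->]]]|_ [y [z [Ky Kz ->]]]].
- by exists (i12 c), 0; rewrite mul0r addr0; split=> //; apply: intermediate_base.
- by exists (y - y'), (z - z'); split; [apply: KB|apply: KB|ring].
- exists (y * y' + z * z' * a ^+ 2), (y * z' + z * y'); split; last by ring.
    by apply: KD; apply/KM => //; apply/KM.
  by apply: KD; apply/KM.
- have [x0|x0] := eqVneq (y + z * a) 0.
    by exists 0, 0; rewrite x0 invr0 mul0r addr0.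
  (* When the conjugate y - z a vanishes, y + z a = 2y is already in K; otherwise the inverse comes
     from multiplication by the conjugate. *)
  have [n0|n0] := eqVneq (y - z * a) 0.
    exists ((y + y)^-1), 0; rewrite mul0r addr0; split=> //; first by apply/KV/KD.
    by move/eqP: n0; rewrite subr_eq0 => /eqP <-.
  exists (y / (y ^+ 2 - z ^+ 2 * a ^+ 2)), (- z / (y ^+ 2 - z ^+ 2 * a ^+ 2)).
  have Kd : K (y ^+ 2 - z ^+ 2 * a ^+ 2)^-1.
    by apply/KV/KB; [apply/KM|apply/KM => //; apply/KM].
  split; [by apply/KM|by apply/KM => //; apply/KN|].
  have -> : y ^+ 2 - z ^+ 2 * a ^+ 2 = (y + z * a) * (y - z * a) by ring.
  by field; rewrite x0 n0.
Qed.

(** The new element is a square root in k_2 of a non-square of K. Finiteness over F is carried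
    along, since the next step needs it to find its own non-square. *)
Lemma quadratic_step (K : k2 -> Prop) : intermediate_field i12 K ->
  (exists e, forall x, K x -> inspan iF2 e x) ->
  exists (K' : k2 -> Prop) (a : k2),
    [/\ intermediate_field i12 K', exists e, forall x, K' x -> inspan iF2 e x,
        forall x, K x -> K' x, K' a & ~ K a /\ K (a ^+ 2)].
Proof.
move=> hK [e Ke].
have Kc c : K (i12 c) by apply: intermediate_base hK c.
have [b Kb hb] := @exists_nonsquare F k2 iF2 t t_nopow K e Ke (Kc _)
  (eq_ind _ K (Kc 1) _ (rmorph1 i12)) (intermediate_mul hK).
have [a ea] : exists a, a ^+ 2 = b.
  have /closed_rootP[a] : size ('X^2 - b%:P : {poly k2}) != 1%N by rewrite size_XnsubC.
  by rewrite /root !hornerE subr_eq0 => /eqP ea; exists a.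
have K2 : K (a ^+ 2) by rewrite ea.
have K0 : K 0 by rewrite -(rmorph0 i12).
have K1 : K 1 by rewrite -(rmorph1 i12).
exists (fun x => exists y z, [/\ K y, K z & x = y + z * a]), a; split.
- exact: quadratic_extension.
- exists (e ++ [seq x * a | x <- e]) => _ [y [z [/Ke Ky /Ke Kz ->]]].
  apply: inspanD.
    move: y Ky; apply: inspan_ind => [|x x'|c x|x xe].
    - exact: inspan0.
    - exact: inspanD.
    - exact: inspanZ.
    - by apply: inspan_mem; rewrite mem_cat xe.
  move: z Kz; apply: inspan_ind => [|x x'|c x|x xe].
  - by rewrite mul0r; apply: inspan0.
  - by rewrite mulrDl; apply: inspanD.
  - by rewrite -mulrA; apply: inspanZ.
  - by apply: inspan_mem; rewrite mem_cat; apply/orP; right; apply/mapP; exists x.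
- by move=> x Kx; exists x, 0; rewrite mul0r addr0.
- by exists 0, 1; rewrite mul1r add0r.
- by split=> // Ka; have := hb a Ka; rewrite ea eqxx.
Qed.

Lemma exists_quadratic_tower : exists (K : nat -> k2 -> Prop) (a : nat -> k2),
  (forall x, K 0%N x -> exists c, x = i12 c) /\
  forall n, [/\ intermediate_field i12 (K n), forall x, K n x -> K n.+1 x,
    K n.+1 (a n), ~ K n (a n) & K n (a n ^+ 2)].
Proof.
pose good (K : k2 -> Prop) := intermediate_field i12 K /\
  exists e, forall x, K x -> inspan iF2 e x.
have good0 : good (fun x => exists c, x = i12 c).
  split.
    split=> [c|_ _ [c ->] [d ->]|_ _ [c ->] [d ->]|_ [c ->]].
    - by exists c.
    - by exists (c - d); rewrite rmorphB.
    - by exists (c * d); rewrite rmorphM.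
    - by exists c^-1; rewrite fmorphV.
  have [e he] := k1_finite; exists (map i12 e) => _ [c ->].
  have [v ->] := he c; exists v; rewrite size_map rmorph_sum.
  by apply: eq_bigr => i _; rewrite rmorphM (nth_map 0).
(* Bundling each field with its finiteness allows a choice function for [quadratic_step] to be
   iterated, starting from the image of k_1. *)
pose T := {K | good K}.
have /choice[f hf] : forall s : T, exists s' : T * k2,
    [/\ forall x, sval s x -> sval s'.1 x, sval s'.1 s'.2,
        ~ sval s s'.2 & sval s (s'.2 ^+ 2)].
  move=> [K [hK Ke]]; have [K' [a [h1 h2 h3 h4 [h5 h6]]]] := quadratic_step hK Ke.
  by exists (exist _ K' (conj h1 h2), a).
pose st n := iter n (fun s => (f s).1) (exist _ _ good0 : T).
exists (fun n => sval (st n)), (fun n => (f (st n)).2); split=> // n.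
have [h1 h2 h3 h4] := hf (st n); split=> //.
exact: (proj2_sig (st n)).1.
Qed.

End QuadraticTower.

(** * Purely transcendental extensions *)

Section Transcendence.
Variables (k0 k1 : fieldType) (i01 : {rmorphism k0 -> k1}).
Variables (n : nat) (t : 'I_n -> k1).
Hypothesis t_indep : algebraically_independent i01 t.

Let ev : {rmorphism {mpoly k0[n]} -> k1} := mmap i01 t.

Lemma ev_neq0 p : p != 0 -> ev p != 0.
Proof. by apply: contraNneq => /t_indep->. Qed.

(** The fractions form an intermediate field containing every t_i. *)
Lemma adjoin_fraction x : adjoin i01 (fun a => exists i, a = t i) x ->
  exists p q : {mpoly k0[n]}, q != 0 /\ x = ev p / ev q.
Proof.
move=> h; apply: (h (fun x => exists p q : {mpoly k0[n]}, q != 0 /\ x = ev p / ev q)); last first.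
  move=> _ [i ->]; exists 'X_i, 1; rewrite oner_neq0 rmorph1 divr1; split=> //.
  by rewrite /ev /= mmapX mmap1U.
move: h => _; split=> [c|_ _ [p [q [q0 ->]]] [p' [q' [q0' ->]]]|_ _ [p [q [q0 ->]]] [p' [q' [q0'
  ->]]]|_ [p [q [q0 ->]]]].
- exists c%:MP, 1; rewrite oner_neq0 rmorph1 divr1; split=> //.
  by rewrite /ev /= mmapC.
- exists (p * q' - p' * q), (q * q'); rewrite mulf_neq0 //; split=> //.
  rewrite rmorphB !rmorphM; field.
  by rewrite !ev_neq0.
- exists (p * p'), (q * q'); rewrite mulf_neq0 //; split=> //.
  by rewrite !rmorphM; field; rewrite !ev_neq0.
- have [->|p0] := eqVneq p 0.
    by exists 0, 1; rewrite oner_neq0 !rmorph0 !mul0r invr0.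
  by exists q, p; rewrite p0 invf_div.
Qed.

Lemma msizeX_pred (p : {mpoly k0[n]}) m : p != 0 ->
  (msize (p ^+ m)).-1 = (m * (msize p).-1)%N.
Proof.
move=> p0; have gt0 (q : {mpoly k0[n]}) : q != 0 -> (0 < msize q)%N.
  by rewrite lt0n msize_poly_eq0.
elim: m => [|m IH]; first by rewrite expr0 msize1.
rewrite exprS msizeM ?expf_neq0 // mulSn -IH.
have := gt0 _ p0; have := gt0 _ (expf_neq0 m p0).
by case: (msize _) => //; case: (msize _) => // a b _ _; rewrite addnS.
Qed.

(** With x = p/q, clearing denominators gives p^m = X_i^e q^m; comparing total degrees shows that m
    divides e, impossible for 0 < e < m. *)
Lemma generator_no_power i m e x : (0 < e < m)%N ->
  adjoin i01 (fun a => exists i, a = t i) x -> x ^+ m != t i ^+ e.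
Proof.
move=> /andP[e0 em] /adjoin_fraction[p [q [q0 ->]]]; apply/eqP => h.
have : ev (p ^+ m - 'X_i ^+ e * q ^+ m) = 0.
  rewrite rmorphB rmorphM !rmorphXn.
  have -> : ev 'X_i = t i by rewrite /ev /= mmapX mmap1U.
  by rewrite -h expr_div_n mulfVK ?subrr // expf_neq0 // ev_neq0.
move/t_indep/eqP; rewrite subr_eq0 => /eqP epq.
have X0 : 'X_i != 0 :> {mpoly k0[n]} by rewrite -msize_poly_eq0 msizeX.
have p0 : p != 0.
  apply: contraTneq (mulf_neq0 (expf_neq0 e X0) (expf_neq0 m q0)) => p0.
  by rewrite -epq p0 expr0n gtn_eqF ?eqxx // (leq_trans _ em).
have := congr1 (fun f : {mpoly k0[n]} => (msize f).-1) epq.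
rewrite /= msizeM ?expf_neq0 // msizeX_pred //.
have hX : (msize ('X_i ^+ e : {mpoly k0[n]})).-1 = e by rewrite msizeX_pred // msizeX mdeg1 muln1.
have hq := msizeX_pred m q0.
have g1 : (0 < msize ('X_i ^+ e : {mpoly k0[n]}))%N by rewrite lt0n msize_poly_eq0 expf_neq0.
have g2 : (0 < msize (q ^+ m))%N by rewrite lt0n msize_poly_eq0 expf_neq0.
move=> hh; have : (m %| e)%N.
  have ee : (m * (msize p).-1 = e + m * (msize q).-1)%N by rewrite hh -hq; move: g1 g2 hX;
    move: (msize _) (msize _) => A B; lia.
  have : (m %| e + m * (msize q).-1)%N by rewrite -ee dvdn_mulr.
  by rewrite dvdn_addl ?dvdn_mulr.
by move/(dvdn_leq e0); rewrite leqNgt em.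
Qed.

Lemma generator_transcendental i (p : {poly k0}) : p != 0 -> (map_poly i01 p).[t i] != 0.
Proof.
move=> p0; pose P : {mpoly k0[n]} := (map_poly (@mpolyC n k0) p).['X_i].
have eP : ev P = (map_poly i01 p).[t i].
  rewrite /P -horner_map -map_poly_comp.
  have -> : ev 'X_i = t i by rewrite /ev /= mmapX mmap1U.
  by congr _.[_]; apply: eq_map_poly => c; rewrite /ev /= mmapC.
rewrite -eP ev_neq0 //; apply: contraNneq p0 => P0; apply/eqP/polyP => j.
have := congr1 (fun f : {mpoly k0[n]} => f@_(U_(i) *+ j)) P0.
rewrite /P (@horner_coef_wide _ (size p)) ?size_poly // mcoeff0 raddf_sum coef0 => h.
have hinj (a b : nat) : (U_(i) *+ a == U_(i) *+ b)%MM = (a == b) :> bool.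
  apply/eqP/eqP => [/mnmP/(_ i)|->] //.
  by rewrite !mulmnE mnm1E eqxx !mul1n.
have [jp|pj] := ltnP j (size p); last by rewrite nth_default.
move: h; rewrite (bigD1 (Ordinal jp)) //= big1 ?addr0 => [|l lj].
  by rewrite coef_map mcoeffCM mcoeffXn hinj eqxx mulr1.
rewrite coef_map mcoeffCM mcoeffXn hinj.
by rewrite -val_eqE /= in lj; rewrite (negbTE lj) mulr0.
Qed.

End Transcendence.

Section FunctionField.
Variables (k0 k1 : fieldType) (i01 : {rmorphism k0 -> k1}).

(** Here tau is the first member of a transcendence basis t. As k_1 is generated by finitely many
    elements algebraic over F = k_0(t), it is finite over F, and t_0 has the roots in F that
    [generator_no_power] allows, so the tower can be built over k_1. *)
Lemma function_field_tower (k2 : closedFieldType) (i12 : {rmorphism k1 -> k2}) :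
  function_field i01 ->
  exists tau : k1, (forall p : {poly k0}, p != 0 -> (map_poly i01 p).[tau] != 0) /\
  exists (K : nat -> k2 -> Prop) (a : nat -> k2),
  (forall x, K 0%N x -> exists c, x = i12 c) /\
  forall n, [/\ intermediate_field i12 (K n), forall x, K n x -> K n.+1 x,
    K n.+1 (a n), ~ K n (a n) & K n (a n ^+ 2)].
Proof.
case=> -[s hs] [n n0 [t [t_indep t_alg]]].
pose i0 := Ordinal n0; exists (t i0).
split=> [p|]; first exact: (generator_transcendental t_indep).
have hA := adjoin_intermediate i01 (fun a => exists i, a = t i).
pose K := field_pred hA; pose iF := subfield_val K.
have tK i : t i \in K by apply/field_predP => S hS; apply; exists i.
have alg x : algebraicOver iF x.
  have [p [p0 pS px]] := t_alg x.
  have pK i : p`_i \in K by apply/field_predP; apply: pS.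
  pose q : {poly subfield K} := \poly_(i < size p) (Sub p`_i (pK i)).
  have eq : map_poly iF q = p.
    apply/polyP => i; rewrite coef_map coef_poly; case: ltnP => hi.
      by [].
    by rewrite nth_default.
  exists q; last by rewrite eq.
  by apply: contraNneq p0 => q0; rewrite -eq q0 rmorph0.
have [e [eR es]] := finite_span_subring (fun x (_ : x \in s) => alg x).
apply: (@exists_quadratic_tower k1 (subfield K) k2 i12 iF (Sub (t i0) (tK i0))).
  move=> m d b hd; have := generator_no_power t_indep i0 hd (field_predP hA _ (valP b)).
  by apply: contraNneq => /(congr1 iF); rewrite !rmorphXn => h; apply/eqP.
(* The span of e over F is an intermediate field containing the generators of k_1, hence all of
   k_1. *)
exists e => x; apply: (hs x); last by move=> a /es.
have [e1 eM] := eR; split=> [c|y z|y z|y].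
- have cK : i01 c \in K by apply/field_predP; apply: intermediate_base hA c.
  have -> : i01 c = iF (Sub (i01 c) cK) * 1 by rewrite mulr1.
  exact: inspanZ.
- by move=> hy hz; apply: inspanD => //; apply: inspanN.
- exact: eM.
- exact: inspan_inv.
Qed.

End FunctionField.

(** * The degree function *)

Lemma map_mpoly_inj (k L : fieldType) (j : {rmorphism k -> L}) :
  injective (map_mpoly j : {mpoly k[2]} -> {mpoly L[2]}).
Proof.
move=> x y e; apply/mpolyP => m; apply: (fmorph_inj j).
by rewrite -!mcoeff_map_mpoly e.
Qed.

Section Degree.
Variables (L : fieldType) (beta : nat -> L).
Hypothesis lead_ex : forall x : {mpoly L[2]}, x != 0 ->
  exists d c, c != 0 /\ lead beta d x c.
Local Notation lead := (lead beta).
Implicit Types x y : {mpoly L[2]}.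

(** In negative degrees [lead_pred] only provides some coefficient c; adding zero to itself yields c
    + c = c. *)
Lemma lead0 d : lead d 0 0.
Proof.
have h := leadC beta 0; rewrite mpolyC0 in h.
have : forall n : nat, lead n%:Z 0 0 /\ lead (- n%:Z) 0 0.
  elim=> [|n [h1 h2]]; first by rewrite oppr0.
  split; first by apply: (lead_lt h1); lia.
  have [c hc] := lead_pred h2.
  have e : - n.+1%:Z = - n%:Z - 1 by lia.
  rewrite e; suff c0 : c = 0 by move: hc; rewrite c0.
  have hcc := leadD hc hc; rewrite addr0 in hcc.
  by apply: (addrI c); rewrite addr0; apply/esym/(lead_unique hc hcc).
by case: (intP d) => [|n|n] /(_ _); [move/(_ 0%N)=> []|move/(_ n.+1)=> []|move/(_ n.+1)=> []].
Qed.

Lemma lead_degree_unique d d' x c c' : lead d x c -> c != 0 -> lead d' x c' -> c' != 0 -> d = d'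
  /\ c = c'.
Proof.
move=> h c0 h' c0'; case: (ltgtP d d') => hd.
- by rewrite (lead_unique (lead_lt h hd) h') eqxx in c0'.
- by rewrite (lead_unique (lead_lt h' hd) h) eqxx in c0.
- by split=> //; move: h'; rewrite -hd; apply: lead_unique.
Qed.

Definition ldeg x : option int :=
  if pselect (exists d, exists2 c, c != 0 & lead d x c) is left h
  then Some (projT1 (cid h)) else None.

Lemma ldegE d x c : lead d x c -> c != 0 -> ldeg x = Some d.
Proof.
move=> h c0; rewrite /ldeg; case: pselect => [h'|]; last by case; exists d, c.
case: (cid h') => d' /= [c' c0' hd']; congr Some.
by have [] := lead_degree_unique hd' c0' h c0.
Qed.

Lemma ldegP x : (x = 0 /\ ldeg x = None) \/
  exists d c, [/\ c != 0, lead d x c & ldeg x = Some d].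
Proof.
have [->|x0] := eqVneq x 0.
  left; split=> //; rewrite /ldeg; case: pselect => // -[d [c c0 h]]; case/eqP: c0.
  exact: lead_unique h (lead0 d).
have [d [c [c0 h]]] := lead_ex x0; right; exists d, c; split=> //.
exact: ldegE h c0.
Qed.

Lemma lead_ldeg d x : dle (ldeg x) (Some d) <-> exists c, lead d x c.
Proof.
have [[-> ->]|[d' [c [c0 h ->]]]] := ldegP x.
  by split=> // _; exists 0; apply: lead0.
split=> /= [|[c' h']].
  by rewrite le_eqVlt => /orP[/eqP<-|hd]; [exists c|exists 0; apply: lead_lt h hd].
rewrite leNgt; apply/negP => dd'.
by have := lead_unique h (lead_lt h' dd'); move/eqP; rewrite (negbTE c0).
Qed.

Lemma lead_ldeg_lt d x : lead d x 0 <-> dlt (ldeg x) (Some d).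
Proof.
rewrite dltSE; split=> [/lead_pred|] h; first exact/lead_ldeg.
by have [c hc] := (lead_ldeg _ _).1 h; apply: (lead_lt hc); lia.
Qed.

Lemma ldeg_is_degree : is_degree_function ldeg.
Proof.
split=> [x|x y|x y].
- split=> [|->]; first by have [[->]//|[d [c [_ _ ->]]]] := ldegP x.
  have [[]//|[d [c [c0 h _]]]] := ldegP 0.
  by case/eqP: c0; apply: lead_unique h (lead0 d).
- have [[-> ex]|[d [c [c0 h ->]]]] := ldegP x; first by rewrite mul0r ex.
  have [[-> ey]|[d' [c' [c0' h' ->]]]] := ldegP y; first by rewrite mulr0 ey.
  by apply: (ldegE (leadM h h')); rewrite mulf_neq0.
- have [[-> ex]|[d [c [c0 h ex]]]] := ldegP x.
    by rewrite add0r ex /dmax /=; case: (ldeg y) => //= ?; apply: lexx.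
  have [[-> ey]|[d' [c' [c0' h' ey]]]] := ldegP y.
    by rewrite addr0 ex ey /dmax /=.
  have [dd|dd] := lerP d d'.
    have -> : dmax (ldeg x) (ldeg y) = Some d' by rewrite ex ey /dmax /= dd.
    have [b hb] : exists b, lead d' x b by apply/lead_ldeg; rewrite ex.
    by apply/lead_ldeg; exists (b + c'); apply: leadD.
  have -> : dmax (ldeg x) (ldeg y) = Some d by rewrite ex ey /dmax /= leNgt dd.
  have [b hb] : exists b, lead d y b by apply/lead_ldeg; rewrite ey /= ltW.
  by apply/lead_ldeg; exists (c + b); apply: leadD.
Qed.

Section Restriction.
Variables (k : fieldType) (j : {rmorphism k -> L}).
Implicit Types f g : {mpoly k[2]}.

Definition leadk d f c := lead d (map_mpoly j f) c.

Lemma degk_is_degree : is_degree_function (fun f => ldeg (map_mpoly j f)).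
Proof.
have [h1 h2 h3] := ldeg_is_degree; split=> [f|f g|f g].
- rewrite h1; split=> [|->]; last exact: rmorph0.
  by rewrite -(rmorph0 (map_mpoly j)); apply: map_mpoly_inj.
- by rewrite rmorphM h2.
- by rewrite rmorphD; apply: h3.
Qed.

(** Taking for j the embeddings of k_0, k_1 and k_2 in k_2 gives the three degree functions, which
    makes their compatibility nearly definitional. *)
Definition degk := DegreeFunction degk_is_degree.

Lemma leadk0 d : leadk d 0 0.
Proof. by rewrite /leadk rmorph0; apply: lead0. Qed.

Lemma leadkD d f g c c' : leadk d f c -> leadk d g c' -> leadk d (f + g) (c + c').
Proof. by rewrite /leadk rmorphD; apply: leadD. Qed.

Lemma leadkM d d' f g c c' : leadk d f c -> leadk d' g c' -> leadk (d + d') (f * g) (c * c').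
Proof. by rewrite /leadk rmorphM; apply: leadM. Qed.

Lemma leadkC c : leadk 0 c%:MP (j c).
Proof. by rewrite /leadk map_mpolyC; apply: leadC. Qed.

Lemma leadkZ d f c a : leadk d f c -> leadk d (a *: f) (j a * c).
Proof. by move=> h; rewrite -mul_mpolyC -[d]add0r; apply: leadkM => //; apply: leadkC. Qed.

Lemma leadkX : leadk 2 'X_0 1.
Proof. by rewrite /leadk map_mpolyX; apply: leadX. Qed.

Lemma leadkY : leadk 3 'X_1 (beta 0).
Proof. by rewrite /leadk map_mpolyX; apply: leadY. Qed.

Lemma leadkXn d f c n : leadk d f c -> leadk (d *+ n) (f ^+ n) (c ^+ n).
Proof.
move=> h; elim: n => [|n IH]; last by rewrite mulrS !exprS; apply: leadkM.
by rewrite mulr0n !expr0 -mpolyC1 -(rmorph1 j); apply: leadkC.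
Qed.

Lemma leadk_sum d (I : eqType) (r : seq I) (F : I -> {mpoly k[2]}) (c : I -> L) :
  (forall i, i \in r -> leadk d (F i) (c i)) ->
  leadk d (\sum_(i <- r) F i) (\sum_(i <- r) c i).
Proof.
elim: r => [|i r IH] h; first by rewrite !big_nil; apply: leadk0.
rewrite !big_cons; apply: leadkD; first by apply: h; rewrite mem_head.
by apply: IH => l lr; apply: h; rewrite inE lr orbT.
Qed.

Lemma leadk_mon m : leadk (wt m)%:Z 'X_[m] (beta 0 ^+ m 1).
Proof.
have -> : 'X_[m] = 'X_0 ^+ m 0 * 'X_1 ^+ m 1 :> {mpoly k[2]}.
  rewrite !mpolyXn -mpolyXD; congr 'X_[_]; apply/mnmP => i.
  rewrite mnmDE !mulmnE !mnm1E.
  have [->|->] : i = 0 \/ i = 1.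
    by case: i => [[|[|]]] // hi; [left|right]; apply: val_inj.
    by rewrite eqxx mul1n mul0n addn0.
  by rewrite eqxx mul1n mul0n.
have := leadkM (leadkXn (m 0) leadkX) (leadkXn (m 1) leadkY).
rewrite expr1n mul1r (_ : 2 *+ m 0 + 3 *+ m 1 = (wt m)%:Z) //.
by rewrite /wt; lia.
Qed.

Lemma degkE d f c : leadk d f c -> c != 0 -> degk f = Some d.
Proof. exact: ldegE. Qed.

Lemma degkP f : (f = 0 /\ degk f = None) \/
  exists d c, [/\ c != 0, leadk d f c & degk f = Some d].
Proof.
have [[/eqP f0 e]|h] := ldegP (map_mpoly j f); last by right.
left; split=> //; apply/eqP.
by move: f0; rewrite -(rmorph0 (map_mpoly j)) (inj_eq (@map_mpoly_inj _ _ j)).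
Qed.

Lemma leadk_degk d f : dle (degk f) (Some d) <-> exists c, leadk d f c.
Proof. exact: lead_ldeg. Qed.

Lemma leadk_degk_lt d f : leadk d f 0 <-> dlt (degk f) (Some d).
Proof. exact: lead_ldeg_lt. Qed.

Lemma degkC c : c != 0 -> degk c%:MP = Some 0.
Proof. by move=> c0; apply: degkE (leadkC c) _; rewrite fmorph_eq0. Qed.

Lemma degkC_le c : dle (degk c%:MP) (Some 0).
Proof. by apply/leadk_degk; exists (j c); apply: leadkC. Qed.

(** * Counting dimensions in a filtration with finitely many leading coefficients *)

Section Count.
Variable e : seq L.
Hypothesis lead_span : forall f, f != 0 -> exists d c,
  [/\ 0 <= d, c != 0, leadk d f c & inspan j e c].

Variable s : nat.
Let N := (s * s)%N.
(** For l < s * s these are the monomials X^a Y^b with a, b < s. *)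
Let mon (l : nat) : 'X_{1..2} := (U_(0%R) *+ (l %/ s) + U_(1%R) *+ (l %% s))%MM.
Let comb (v : 'rV[k]_N) : {mpoly k[2]} := \sum_l v 0 l *: 'X_[mon l].

Lemma grid_monomial_inj : injective mon.
Proof.
move=> a b /mnmP h; have := h 0; have := h 1.
rewrite /mon !mnmDE !mulmnE !mnm1E !eqxx /= !mul0n !mul1n !addn0 !add0n => h1 h2.
by rewrite (divn_eq a s) (divn_eq b s) h1 h2.
Qed.

Lemma comb_inj v : comb v = 0 -> v = 0.
Proof.
move=> h; apply/rowP => l; rewrite mxE.
have := congr1 (fun f : {mpoly k[2]} => f@_(mon l)) h.
rewrite mcoeff0 raddf_sum (bigD1 l) //= mcoeffZ mcoeffX eqxx mulr1 big1 ?addr0 //.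
move=> l' ll'; rewrite mcoeffZ mcoeffX (inj_eq grid_monomial_inj).
by rewrite -[(_ == _)]/(l' == l) (negbTE ll') mulr0.
Qed.

Lemma comb_mul m (u : 'rV[k]_m) (A : 'M[k]_(m, N)) :
  comb (u *m A) = \sum_l u 0 l *: comb (row l A).
Proof.
rewrite /comb; under [RHS]eq_bigr do rewrite scaler_sumr.
rewrite exchange_big; apply: eq_bigr => b _; rewrite mxE scaler_suml.
by apply: eq_bigr => l _; rewrite mxE scalerA.
Qed.

(** Induction on the filtration: below degree 0 only zero remains, and each further degree adds at
    most [size e] dimensions. Indeed the coordinates along e of the coefficients in degree d form a
    matrix C, and the combinations in the kernel of C have degree less than d. *)
Lemma rank_bound d m (A : 'M[k]_(m, N)) :
  (forall i, exists c, leadk (d%:Z - 1) (comb (row i A)) c) ->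
  (\rank A <= d * size e)%N.
Proof.
elim: d m A => [|d IH] m A hA.
  suff -> : A = 0 by rewrite mxrank0.
  apply/row_matrixP => i; rewrite row0; apply: comb_inj; apply/eqP.
  apply: contraT => /lead_span[d [c [d0 c0 h _]]]; have [c' h'] := hA i.
  have := lead_unique h (lead_lt h' _); rewrite (lt_le_trans _ d0) // => /(_ isT) /eqP.
  by rewrite (negbTE c0).
have ed : d.+1%:Z - 1 = d%:Z by lia.
rewrite ed in hA.
have /choice[a ha] : forall i, exists a : nat -> k,
    leadk d%:Z (comb (row i A)) (\sum_(l < size e) j (a l) * e`_l).
  move=> i; have [c hc] := hA i.
  have [c0|c0] := eqVneq c 0.
    exists (fun=> 0); rewrite big1 -?c0 // => l _; by rewrite rmorph0 mul0r.
  have f0 : comb (row i A) != 0.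
    by apply: contraNneq c0 => f0; apply/eqP; apply: lead_unique hc _;
      rewrite -/(leadk _ _ _) f0; apply: leadk0.
  have [d' [c' [_ c0' h' [a ea]]]] := lead_span f0.
  by exists a; rewrite -ea; have [_ <-] := lead_degree_unique hc c0 h' c0'.
pose C := \matrix_(i < m, l < size e) a i l.
have : (\rank (kermx C *m A) <= d * size e)%N.
  apply: IH => i; rewrite row_mul comb_mul; apply: lead_pred.
  set c := (X in lead _ _ X); pose u := row i (kermx C).
  have uC : u *m C = 0 by rewrite -row_mul mulmx_ker row0.
  have := leadk_sum (r := index_enum 'I_m) (F := fun l => u 0 l *: comb (row l A))
    (d := d%:Z) (fun l _ => leadkZ (u 0 l) (ha l)).
  congr lead; under eq_bigr do rewrite mulr_sumr; rewrite exchange_big.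
  rewrite big1 // => b _.
  transitivity (j ((u *m C) 0 b) * e`_b); last by rewrite uC mxE rmorph0 mul0r.
  rewrite mxE rmorph_sum mulr_suml; apply: eq_bigr => l _.
  by rewrite [C l b]mxE rmorphM mulrA.
have := mxrank_mul_min (kermx C) A; rewrite mxrank_ker.
have := rank_leq_col C; have := rank_leq_row C; lia.
Qed.

(** The monomials of the grid have weight at most 5s, so their span lies below degree 5s + 1. *)
Lemma monomial_count : (s * s <= (5 * s).+1 * size e)%N.
Proof.
rewrite -/N -(mxrank1 k N); apply: rank_bound => i.
exists (\sum_l (j ((row i 1%:M : 'rV[k]_N) 0 l) *
  (if wt (mon l) == (5 * s)%N then beta 0 ^+ (mon l) 1 else 0))).
apply: leadk_sum => l _; apply: leadkZ.
have -> : (5 * s).+1%:Z - 1 = (5 * s)%:Z by lia.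
have : (wt (mon l) <= 5 * s)%N.
  rewrite /wt /mon !mnmDE !mulmnE !mnm1E !eqxx /= !mul0n !mul1n !addn0 !add0n.
  move: (nat_of_ord l) (ltn_ord l : (l < s * s)%N) => n nN.
  have s0 : (0 < s)%N by case: (posnP s) nN => // ->.
  have h1 : (n %/ s < s)%N by rewrite ltn_divLR.
  have h2 : (n %% s < s)%N by rewrite ltn_mod.
  by lia.
rewrite leq_eqVlt; case: eqP => [<- _|_ /= h]; first exact: leadk_mon.
by apply: (lead_lt (leadk_mon _)); rewrite ltz_nat.
Qed.

End Count.

(** Taking s = 6 [size e] + 1 makes the quadratic count exceed the linear bound. This serves twice:
    to find negative degrees over k_2 and to exclude a finite extension containing the leading
    coefficients over k_1. *)
Lemma lead_not_finite e : ~ forall f, f != 0 -> exists d c,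
  [/\ 0 <= d, c != 0, leadk d f c & inspan j e c].
Proof.
move=> h; have := monomial_count h (6 * size e).+1; lia.
Qed.

End Restriction.
End Degree.

(** * The derivation with respect to Y, for L algebraic over k *)

Section Derivation.
Variables (k L : fieldType) (j : {rmorphism k -> L}) (beta : nat -> L).
Hypothesis lead_ex : forall x : {mpoly L[2]}, x != 0 ->
  exists d c, c != 0 /\ lead beta d x c.
Hypothesis char0 : [pchar L] =i pred0.
Hypothesis alg : forall z : L, algebraicOver j z.
Local Notation B := {mpoly k[2]}.
Local Notation lk := (leadk beta j).
Local Notation D := (mderiv (1 : 'I_2)).

(** An annihilator q of least degree works: in characteristic zero q' is non-zero and of smaller
    degree, so it cannot vanish at z. *)
Lemma minimal_separable z : exists q : {poly k},
  [/\ q != 0, (map_poly j q).[z] = 0 & (map_poly j q^`()).[z] != 0].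
Proof.
have hex : exists n, `[< exists2 q : {poly k}, q != 0 & root (map_poly j q) z /\ size q = n >].
  by have [q q0 qz] := alg z; exists (size q); apply/asboolP; exists q.
case: (ex_minnP hex) => n /asboolP[q q0 [qz qn]] hmin; exists q; split=> //; first exact/eqP.
have q1 : (1 < size q)%N.
  by rewrite -(size_map_poly j); apply: root_size_gt1 qz; rewrite map_poly_eq0.
apply/negP => dq0; have dq : q^`() != 0.
  apply: contraTneq q1 => h; have := congr1 (fun p : {poly k} => p`_(size q).-2) h.
  rewrite coef0 coef_deriv => /eqP; rewrite -mulr_natl mulf_eq0 => /orP[/eqP e|].
    have /pcharf0P/(_ (size q).-2.+1) := char0.
    by rewrite -(rmorph_nat j) e rmorph0 eqxx.
  case: ltnP => // sq; rewrite (_ : (size q).-2.+1 = (size q).-1); last by lia.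
  by rewrite -[_`_ _]/(lead_coef q) lead_coef_eq0 (negbTE q0).
have : (n <= size q^`())%N.
  by apply: hmin; apply/asboolP; exists q^`().
by rewrite -qn leqNgt lt_size_deriv.
Qed.

Lemma mderivXn (f : B) n : D (f ^+ n.+1) = f ^+ n * D f *+ n.+1.
Proof.
elim: n => [|n IH]; first by rewrite expr1 expr0 mul1r.
rewrite exprS mderivM IH mulrnAr mulrA -exprS mulrC.
by rewrite [in RHS]mulrS mulrC.
Qed.

Lemma mderiv_X0 n : D ('X_0 ^+ n : B) = 0.
Proof.
case: n => [|n]; first by rewrite expr0 -mpolyC1 mderivC.
rewrite mderivXn mderivX mnm1E (_ : (0 == 1 :> 'I_2) = false) //.
by rewrite scale0r mulr0 mul0rn.
Qed.

(* If the supremum were attained at f, then with c the leading coefficient of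
   f^2 X^n / X^p (a quotient of degree 0) and q its minimal polynomial over k, the
   homogenized polynomial g = q(f^2 X^n / X^p) X^(p deg q) has smaller degree than
   expected while D g has not, since q'(c) <> 0. *)
Lemma derivation_degree_undefined :
  ~ derivation_degree_defined (degk lead_ex j) D.
Proof.
case=> u [[f f0 eu] umax].
have Xf : ('X_1 : B) != 0 by rewrite -msize_poly_eq0 msizeX.
have deg1 : degk lead_ex j 1 = Some 0 by rewrite -mpolyC1 degkC ?oner_neq0.
have DY : D ('X_1 : B) = 1.
  rewrite mderivX mnm1E eqxx scale1r (_ : (_ - _)%MM = 0%MM) ?mpolyX0 //.
  by apply/mnmP => i; rewrite mnmBE mnm0E subnn.
have umax' (x : B) : x != 0 -> dle (dsub (degk lead_ex j (D x)) (degk lead_ex j x)) u.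
  by move=> x0; apply: umax; exists x; [exact: x0|reflexivity].
have u0 : u <> None.
  move=> u0; have := umax' _ Xf; rewrite DY.
  rewrite u0 deg1; have [[e _]|[d [c [_ _ ->]]] //] := degkP lead_ex j 'X_1.
  by rewrite e eqxx in Xf.
have [[e _]|[a [cf [cf0 hf ef]]]] := degkP lead_ex j f; first by rewrite e eqxx in f0.
have [[_ e]|[dD [cD [cD0 hD eD]]]] := degkP lead_ex j (D f).
  by rewrite e in eu.
rewrite eD ef /= in eu.
(* Since X has degree 2, both f^2 X^n and X^p have degree 2p when deg f = p - n. *)
have [p [n ea]] : exists p n : nat, a = p%:Z - n%:Z.
  by exists (absz (Num.max a 0)), (absz (Num.max (- a) 0)); lia.
pose phi := f ^+ 2 * 'X_0 ^+ n; pose ps : B := 'X_0 ^+ p.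
have hphi : lk (p%:Z * 2) phi (cf ^+ 2).
  have := leadkM (leadkXn 2 hf) (leadkXn n (leadkX beta j)).
  rewrite expr1n mulr1 (_ : a *+ 2 + 2 *+ n = p%:Z * 2) //; lia.
have hps : lk (p%:Z * 2) ps 1.
  have := leadkXn p (leadkX beta j).
  by rewrite expr1n (_ : 2 *+ p = p%:Z * 2) //; lia.
have [q [q0 qz dqz]] := minimal_separable (cf ^+ 2).
have [r er] : exists r, size q = r.+1.
  by exists (size q).-1; rewrite prednK // size_poly_gt0.
pose g := \sum_(i < r.+1) q`_i *: (phi ^+ i * ps ^+ (r - i)).
(* The polynomial h homogenizes q'; as D kills every power of X, D g = D phi * h. *)
pose h := \sum_(i < r) (q`_i.+1 *+ i.+1) *: (phi ^+ i * ps ^+ (r - i.+1)).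
have hg : lk (p%:Z * 2 * r%:Z) g 0.
  rewrite -qz horner_coef size_map_poly er; apply: leadk_sum => // i _.
  rewrite coef_map; apply: leadkZ.
  have := leadkM (leadkXn i hphi) (leadkXn (r - i) hps).
  rewrite expr1n mulr1 -mulrnDr subnKC -1?ltnS // => H.
  by rewrite -[r%:Z]natz mulr_natr.
have Dphi : D phi = f * D f * 'X_0 ^+ n *+ 2.
  by rewrite /phi mderivM mderiv_X0 mulr0 addr0 mderivXn expr1 mulrnAl.
have Dps m : D (ps ^+ m) = 0 by rewrite /ps -exprM mderiv_X0.
have Dg : D g = D phi * h.
  rewrite /g raddf_sum big_ord_recl /= mderivZ expr0 mul1r Dps scaler0 add0r.
  rewrite /h mulr_sumr; apply: eq_bigr => i _.
  rewrite mderivZ mderivM Dps mulr0 addr0 mderivXn.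
  rewrite -!mul_mpolyC raddfMn /= /bump /= add1n.
  move: (D phi) (q`_i.+1)%:MP (phi ^+ i) (ps ^+ _) => u1 u2 u3 u4.
  rewrite !(mulrnAl, mulrnAr); congr (_ *+ _).
  by rewrite [u3 * u1]mulrC -[u1 * u3 * u4]mulrA [LHS]mulrCA.
have r0 : (0 < r)%N.
  rewrite lt0n; apply: contraTneq isT => r0; move: qz; rewrite r0 in er.
  have /size_poly1P[d d0 ->] : size q == 1%N by rewrite er.
  by rewrite map_polyC hornerC => /eqP; rewrite fmorph_eq0 (negbTE d0).
have hh : lk (p%:Z * 2 * (r.-1)%:Z) h (map_poly j q^`()).[cf ^+ 2].
  rewrite (@horner_coef_wide _ r); last first.
    by rewrite size_map_poly -ltnS -er lt_size_deriv.
  apply: leadk_sum => // i _.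
  rewrite coef_map coef_deriv; apply: leadkZ.
  have := leadkM (leadkXn i hphi) (leadkXn (r - i.+1) hps).
  rewrite expr1n mulr1 -mulrnDr; have -> : (i + (r - i.+1) = r.-1)%N by have := ltn_ord i; lia.
  by rewrite -[r.-1%:Z]natz [_ * r.-1%:R]mulr_natr.
have hDphi : lk (a + dD + 2 * n%:Z) (D phi) (cf * cD * 2%:R).
  rewrite Dphi -[_ * _ * _ *+ 2]mulr_natr;
    have := leadkM (leadkM hf hD) (leadkXn n (leadkX beta j)).
  rewrite expr1n mulr1 (_ : 2 *+ n = 2 * n%:Z); last by rewrite -[n%:Z]natz mulr_natr.
  move=> H; have := leadkM H (leadkC beta j 2%:R).
  by rewrite addr0 !rmorph_nat.
have two0 : (2%:R : L) != 0 by have /pcharf0P -> := char0.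
have hDg := leadkM hDphi hh; rewrite -Dg in hDg.
have eDg : degk lead_ex j (D g) = Some (a + dD + 2 * n%:Z + p%:Z * 2 * (r.-1)%:Z).
  by apply: degkE hDg _; rewrite !mulf_neq0.
have g0 : g != 0.
  apply: contraTneq isT => g0; move: eDg; rewrite g0 raddf0.
  by have /= -> := degree0 (degk lead_ex j).
have [[e _]|[e [c [_ _ eg]]]] := degkP lead_ex j g; first by rewrite e eqxx in g0.
(* Now deg g < 2pr, whereas deg (D g) = a + dD + 2n + 2p(r - 1). The difference exceeds a + dD + 2n
   - 2p = dD - a = u. *)
have := (leadk_degk_lt lead_ex j _ _).1 hg; rewrite eg /dlt /= -ltNge => lt_e.
have := umax' g g0; rewrite eDg eg eu /=; apply/negP; rewrite -ltNge.
have -> : (r.-1)%:Z = r%:Z - 1 by lia.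
by move: lt_e; rewrite mulrBr mulr1; lia.
Qed.

End Derivation.

(** * Associated graded rings *)

Section GradedRing.
Variables (B : comNzRingType) (deg : degree_function B).
Local Notation gr := (gr_class deg).

Lemma laurent0E n : (0 : laurent B) n = 0.
Proof. by have := ltermE (0 : int) (0 : B) n; rewrite if_same. Qed.

Lemma laurentDE (f g : laurent B) n : (f + g) n = f n + g n.
Proof. exact: laddE. Qed.

Lemma laurentBE (f g : laurent B) n : (f - g) n = f n - g n.
Proof. by rewrite laurentDE; congr (_ + _); apply: loppE. Qed.

Lemma laurentME (f g : laurent B) n : (f * g) n =
  \sum_(i <- finsupp f) \sum_(j <- finsupp g) (f i * g j) *+ (i + j == n).
Proof. exact: lmulE. Qed.

Lemma laurent_sumE (I : Type) (r : seq I) (F : I -> laurent B) n :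
  (\sum_(i <- r) F i) n = \sum_(i <- r) F i n.
Proof.
elim: r => [|i r IH]; first by rewrite !big_nil laurent0E.
by rewrite !big_cons -IH laurentDE.
Qed.

Lemma pi_rees_sum (f : rees deg) :
  (\pi_(Gr deg) f)%qT = \sum_(i <- finsupp (val f)) gr i (val f i).
Proof.
rewrite /gr_class -rmorph_sum; congr (\pi _)%qT; apply: val_inj; rewrite rmorph_sum.
apply/fsfunP => n; rewrite laurent_sumE.
have hf i : dle (deg (val f i)) (Some i) by have /rees_predP := valP f.
under eq_bigr do rewrite /= insubdK ?lterm_rees // ltermE.
have [hn|hn] := finsuppP (val f) n.
  by rewrite big_seq big1 // => i hi; case: eqP => // e; rewrite e hi in hn.
rewrite (bigD1_seq n) ?fset_uniq //= eqxx big1 ?addr0 // => i.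
by rewrite eq_sym => /negbTE->.
Qed.

Lemma gr_ind (P : Gr deg -> Prop) : P 0 -> (forall a b, P a -> P b -> P (a + b)) ->
  (forall i x, dle (deg x) (Some i) -> P (gr i x)) -> forall a, P a.
Proof.
move=> P0 PD Pc a; elim/quotW: a => f; rewrite pi_rees_sum.
by elim/big_ind: _ => // i _; apply: Pc; have /rees_predP := valP f.
Qed.

Lemma gr_class_congr i x y : dle (deg x) (Some i) -> dle (deg y) (Some i) ->
  dlt (deg (x - y)) (Some i) -> gr i x = gr i y.
Proof.
move=> hx hy hl; have h : dle (deg (x - y)) (Some i).
  by apply: dle_degD => //; rewrite degreeN.
rewrite -{1}[x](subrK y) gr_classD //.
by move/(gr_class_eq0 h): hl => ->; rewrite add0r.
Qed.

Lemma gr_class_rep i x (f : rees deg) : dle (deg x) (Some i) ->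
  (\pi_(Gr deg) f)%qT = gr i x -> dlt (deg (val f i - x)) (Some i).
Proof.
move=> hx /eqP; rewrite /gr_class -Quotient.idealrBE => /rees_idealP/(_ i).
rewrite rmorphB /= insubdK ?lterm_rees //.
by rewrite laurentBE ltermE eqxx.
Qed.

Lemma gr_class_exp i x n : dle (deg x) (Some i) ->
  dle (deg (x ^+ n)) (Some (i *+ n)) /\ gr i x ^+ n = gr (i *+ n) (x ^+ n).
Proof.
move=> hx; elim: n => [|n [IH1 IH2]]; first by rewrite !expr0 gr_class1 degree1.
by rewrite !exprS mulrS IH2 gr_classM //; split=> //; apply: dle_degM.
Qed.

Section Structure.
Variables (k : fieldType) (iota : {rmorphism k -> B}).

(** The proof h is an argument of the map so that the ring morphism structure can be attached to it;
    the map itself is the one in [gr_finitely_generated]. *)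
Definition grphi (h : forall c, dle (deg (iota c)) (Some 0)) (c : k) : Gr deg :=
  gr 0 (iota c).

Variable h : forall c, dle (deg (iota c)) (Some 0).

Lemma grphiB : zmod_morphism (grphi h).
Proof.
move=> c d; apply: (addIr (grphi h d)); rewrite subrK /grphi -gr_classD //.
by rewrite -rmorphD subrK.
Qed.

Lemma grphiM : monoid_morphism (grphi h).
Proof.
split; first by rewrite /grphi rmorph1 gr_class1.
by move=> c d; rewrite /grphi gr_classM // addr0 rmorphM.
Qed.

HB.instance Definition _ := GRing.isZmodMorphism.Build k (Gr deg) (grphi h) grphiB.
HB.instance Definition _ := GRing.isMonoidMorphism.Build k (Gr deg) (grphi h) grphiM.

Variables (n : nat) (v : 'I_n -> Gr deg).
Definition gen a : Prop := exists p : {mpoly k[n]}, a = mmap (grphi h) v p.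

Lemma genD a b : gen a -> gen b -> gen (a + b).
Proof. by move=> [p ->] [q ->]; exists (p + q); rewrite rmorphD. Qed.

Lemma genM a b : gen a -> gen b -> gen (a * b).
Proof. by move=> [p ->] [q ->]; exists (p * q); rewrite rmorphM. Qed.

Lemma genC c : gen (grphi h c).
Proof. by exists c%:MP; rewrite mmapC. Qed.

Lemma gen0 : gen 0.
Proof. by exists 0; rewrite rmorph0. Qed.

Lemma gen_var l : gen (v l).
Proof. by exists 'X_l; rewrite mmapX mmap1U. Qed.

Lemma genXn a m : gen a -> gen (a ^+ m).
Proof.
move=> ha; elim: m => [|m IH]; last by rewrite exprS; apply: genM.
by rewrite expr0 -(rmorph1 (grphi h)); apply: genC.
Qed.

End Structure.
End GradedRing.

Section GrLead.
Variables (L : fieldType) (beta : nat -> L).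
Hypothesis lead_ex : forall x : {mpoly L[2]}, x != 0 ->
  exists d c, c != 0 /\ lead beta d x c.

(** * Failure of finite generation when degrees are non-negative *)

Section NotFinitelyGenerated.
Variables (k : fieldType) (j : {rmorphism k -> L}).
Local Notation lk := (leadk beta j).
Local Notation deg := (degk lead_ex j).
Hypothesis deg_ge0 : forall f d, deg f = Some d -> 0 <= d.
Hypothesis alg : forall z : L, algebraicOver j z.

(** Lifts of finitely many generators involve finitely many leading coefficients, all algebraic over
    k, hence lying in a finite k-subalgebra spanned by e. Every leading coefficient would then lie
    there, against [lead_not_finite]. *)
Lemma gr_not_finitely_generated : ~ gr_finitely_generated (@mpolyC 2 k) deg.
Proof.
move=> [n [v hv]].
have /choice[F hF] : forall l : 'I_n, exists f : rees deg, (\pi_(Gr deg) f)%qT = v l.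
  by move=> l; exists (repr (v l)); rewrite reprK.
have lex (f : rees deg) i : exists c, lk i (val f i) c.
  by apply/(leadk_degk lead_ex); have /rees_predP := valP f.
have /choice[C hC] : forall l, exists C : int -> L, forall i, lk i (val (F l) i) (C i).
  by move=> l; have /choice[C hC] := lex (F l); exists C.
pose s := flatten [seq [seq C l i | i <- finsupp (val (F l))] | l <- enum 'I_n].
have [e [[e1 eM] es]] := @finite_span_subring k L j s (fun x _ => alg x).
(* Asking only for some representative with coefficients in the span makes [good] stable under sums
   and products; [gr_class_rep] later shows that the choice does not matter. *)
pose good (a : Gr deg) := exists2 f : rees deg, (\pi_(Gr deg) f)%qT = a &
  forall i, exists2 c, lk i (val f i) c & inspan j e c.
have goodv l : good (v l).
  exists (F l) => // i; have [hi|hi] := finsuppP (val (F l)) i.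
    by exists 0; [apply: leadk0|apply: inspan0].
  exists (C l i) => //; apply: es; apply/flattenP.
  exists [seq C l i | i <- finsupp (val (F l))]; apply/mapP; first by exists l; rewrite ?mem_enum.
  by exists i.
have good0 : good 0.
  exists 0; first exact: rmorph0.
  by move=> i; exists 0; [rewrite [val _]/(0 : laurent _) laurent0E;
    apply: leadk0|apply: inspan0].
have goodD a b : good a -> good b -> good (a + b).
  move=> [f fa hf] [g gb hg]; exists (f + g); first by rewrite -fa -gb; apply: rmorphD.
  move=> i; have [c hc ce] := hf i; have [c' hc' ce'] := hg i.
  exists (c + c'); last exact: inspanD.
  by rewrite [val _]/(val f + val g : laurent _) laurentDE; apply: leadkD.
have spansum (I : eqType) (r : seq I) d (G : I -> {mpoly k[2]}) :
    (forall i, i \in r -> exists2 c, lk d (G i) c & inspan j e c) ->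
    exists2 c, lk d (\sum_(i <- r) G i) c & inspan j e c.
  elim: r => [|i r IH] h; first by rewrite big_nil; exists 0; [apply: leadk0|apply: inspan0].
  rewrite big_cons; have [c hc ce] := h i (mem_head _ _).
  have [|c' hc' ce'] := IH; first by move=> l lr; apply: h; rewrite inE lr orbT.
  by exists (c + c'); [apply: leadkD|apply: inspanD].
have goodM a b : good a -> good b -> good (a * b).
  move=> [f fa hf] [g gb hg]; exists (f * g); first by rewrite -fa -gb; apply: rmorphM.
  move=> i; rewrite [val _]/(val f * val g : laurent _) laurentME.
  apply: (spansum _ _ i) => l _; apply: (spansum _ _ i) => l' _.
  case: eqP => [<-|_]; last by rewrite mulr0n; exists 0; [apply: leadk0|apply: inspan0].
  have [c hc ce] := hf l; have [c' hc' ce'] := hg l'.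
  by exists (c * c'); [rewrite mulr1n; apply: leadkM|apply: eM].
have goodC c : good (gr_class deg 0 c%:MP).
  exists (insubd (0 : rees deg) (lterm 0 c%:MP)) => // i.
  rewrite insubdK ?lterm_rees ?degkC_le // ltermE; case: eqP => [->|_].
    exists (j c); first exact: leadkC.
    by rewrite -[j c]mulr1; apply: inspanZ.
  by exists 0; [apply: leadk0|apply: inspan0].
have good_all a : good a.
  have [p ->] := hv a; rewrite /mmap.
  elim/big_ind: _ => // m _; apply: (goodM); first exact: goodC.
  rewrite /mmap1; elim/big_ind: _ => [|a1 a2|l _]; last first.
  - elim: (m l) => [|q IH]; first by rewrite expr0 -gr_class1 -mpolyC1; apply: goodC.
    by rewrite exprS; apply: (goodM).
  - exact: goodM.
  - by rewrite -gr_class1 -mpolyC1; apply: goodC.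
apply: (lead_not_finite (beta := beta) (j := j) (e := e)) => f f0.
have [[fe _]|[d [c [c0 hc ed]]]] := degkP lead_ex j f; first by rewrite fe eqxx in f0.
exists d, c; split=> //; first exact: deg_ge0 ed.
have dle_f : dle (deg f) (Some d) by rewrite ed /= lexx.
have [g eg hg] := good_all (gr_class deg d f).
have [c' hc' ce'] := hg d.
have /leadk_degk_lt h := gr_class_rep dle_f eg.
suff -> : c = c' by [].
have := leadkD h hc; rewrite subrK add0r => hcc.
exact: lead_unique hcc hc'.
Qed.

End NotFinitelyGenerated.

(** * The case k = L: the degrees fill Z *)

Section OverL.
Local Notation j := (idfun : {rmorphism L -> L}).
Local Notation lk := (leadk beta j).
Local Notation deg := (degk lead_ex j).

Hypothesis beta0 : beta 0 != 0.

(** Otherwise all degrees are non-negative, and the leading coefficients lie in the span of 1 over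
    L, which [lead_not_finite] forbids. *)
Lemma neg_degree_exists : exists f (n : nat), deg f = Some (- n.+1%:Z).
Proof.
apply: contrapT => hN.
apply: (lead_not_finite (beta := beta) (j := j) (e := [:: 1])) => f f0.
have [[fe _]|[d [c [c0 hc ed]]]] := degkP lead_ex j f; first by rewrite fe eqxx in f0.
exists d, c; split=> //; last by exists (fun=> c); rewrite big_ord1 mulr1.
by case: (intP d) ed => [|m|m] // ed; case: hN; exists f, m.
Qed.

Lemma lead_one d f c : c != 0 -> lk d f c -> lk d (c^-1 *: f) 1.
Proof. by move=> c0 h; rewrite -(mulVf c0); apply: leadkZ. Qed.

(** Every integer from 2 on is of the form 2a + 3b, hence the degree of a monomial; together with
    one negative degree -(n+1) this reaches 1 and -1. *)
Lemma unit_degrees : exists u v, lk 1 u 1 /\ lk (- 1) v 1.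
Proof.
have [f [n ef]] := neg_degree_exists.
have [[_ e]|[d [c [c0 hc ed]]]] := degkP lead_ex j f; first by rewrite e in ef.
move: ed; rewrite ef => -[ed]; rewrite -ed in hc.
have h := lead_one c0 hc; set g := _ *: f in h.
have ge2 m : (1 < m)%N -> exists x, lk m%:Z x 1.
  move=> m1; have b0 := beta0.
  have [a [b ab]] : exists a b, (m = 2 * a + 3 * b)%N.
    by case: (boolP (odd m)) => om; [exists (m - 3)./2, 1%N|exists m./2, 0%N]; lia.
  have hY := lead_one b0 (leadkY beta j).
  have := leadkM (leadkXn a (leadkX beta j)) (leadkXn b hY).
  rewrite !expr1n mulr1 (_ : 2 *+ a + 3 *+ b = m%:Z); last by lia.
  by exists ('X_0 ^+ a * ((beta 0)^-1 *: 'X_1) ^+ b).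
(* The factor 3 guarantees 3(n+1) - 1 >= 2 even when n = 0. *)
have [x hx] := ge2 n.+2 isT; have [y hy] : exists y, lk (3 * n.+1%:Z - 1) y 1.
  have [|y hy] := ge2 (3 * n.+1).-1; first by lia.
  by exists y; rewrite (_ : 3 * n.+1%:Z - 1 = (3 * n.+1).-1%:Z) //; lia.
exists (x * g), (y * g ^+ 3); split.
  by have := leadkM hx h; rewrite mulr1 (_ : n.+2%:Z + - n.+1%:Z = 1) //; lia.
have := leadkM hy (leadkXn 3 h); rewrite expr1n mulr1.
by rewrite (_ : 3 * n.+1%:Z - 1 + (- n.+1%:Z) *+ 3 = -1) //; lia.
Qed.

(** Leading coefficients are themselves scalars, so each B_[i] is a line, spanned by the class of a
    power of u or of v. *)
Lemma gr_finitely_generated_closed : gr_finitely_generated (@mpolyC 2 L) deg.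
Proof.
have [u [v [hu hv]]] := unit_degrees.
have du : dle (deg u) (Some 1) by apply/(leadk_degk lead_ex); exists 1.
have dv : dle (deg v) (Some (- 1)) by apply/(leadk_degk lead_ex); exists 1.
pose w (i : 'I_2) := if i == 0 then gr_class deg 1 u else gr_class deg (- 1) v.
exists 2%N, w => a.
have hdeg := degkC_le lead_ex j.
change (gen (iota := @mpolyC 2 L) hdeg w a).
move: a; apply: gr_ind => [|a b|i x hx]; [exact: gen0|exact: genD|].
have [c hc] := (leadk_degk lead_ex j i x).1 hx.
suff [y [Y [hy [dy eY] gY]]] : exists y Y,
    [/\ lk i y 1, dle (deg y) (Some i) /\ gr_class deg i y = Y & gen (iota := @mpolyC 2 L) hdeg
      w Y].
  have dcy : dle (deg (c%:MP * y)) (Some i).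
    by rewrite -[i]add0r; apply: dle_degM => //; apply: degkC_le.
  rewrite (@gr_class_congr _ _ i x (c%:MP * y)) //.
    rewrite -[i]add0r -gr_classM ?degkC_le // eY.
    by apply: genM => //; apply: (genC (iota := @mpolyC 2 L)).
  have h := leadkM (leadkC beta j (- c)) hy; rewrite add0r mulr1 /= in h.
  have := leadkD hc h; rewrite subrr mpolyCN mulNr => h'.
  exact: (leadk_degk_lt lead_ex j i _).1 h'.
have [n [->|->]] : exists n : nat, i = 1 *+ n \/ i = (- 1) *+ n.
  by exists (absz i); rewrite mulNrn natz; lia.
- have [h1 h2] := gr_class_exp n du.
  exists (u ^+ n), (gr_class deg 1 u ^+ n); split=> //.
    by have := leadkXn n hu; rewrite expr1n.
  by apply: genXn; apply: (gen_var (iota := @mpolyC 2 L) hdeg w 0).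
- have [h1 h2] := gr_class_exp n dv.
  exists (v ^+ n), (gr_class deg (- 1) v ^+ n); split=> //.
    by have := leadkXn n hv; rewrite expr1n.
  by apply: genXn; apply: (gen_var (iota := @mpolyC 2 L) hdeg w 1).
Qed.

End OverL.
End GrLead.

(** * Gradings *)

Section GradedDomain.
Variables (k : fieldType) (deg : degree_function {mpoly k[2]}).
Local Notation B := {mpoly k[2]}.
Variable R : int -> B -> Prop.
Hypothesis gR : is_grading R.
Local Notation dec := (homogeneous_decomposition R).
Implicit Types (x y : B) (f g : laurent B).

Lemma laurent_total f (F : {fset int}) : (finsupp f `<=` F)%fset ->
  \sum_(i <- finsupp f) f i = \sum_(i <- F) f i.
Proof. by move=> hF; apply: big_fset_incl => // i _ /fsfun_dflt. Qed.

Lemma dec_term i x : R i x -> dec x (lterm i x).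
Proof.
move=> hx; split=> [l|].
  by rewrite ltermE; case: eqP => [->|_] //; apply: grading0.
by rewrite (laurent_total (lterm_supp i x)) big_seq_fset1 ltermE eqxx.
Qed.

Lemma dec_uniq x f g : dec x f -> dec x g -> f = g.
Proof.
move=> hf hg; have [h [_ hu]] := grading_direct gR x.
by rewrite -(hu _ hf) -(hu _ hg).
Qed.

Lemma dec_ex x : exists f : laurent B, dec x f.
Proof. by have [h [hh _]] := grading_direct gR x; exists h. Qed.

Lemma gradingD i x y : R i x -> R i y -> R i (x + y).
Proof.
move=> hx hy; rewrite -[y]opprK; apply: (gradingB gR) => //.
by rewrite -sub0r; apply: (gradingB gR) => //; apply: grading0.
Qed.

Lemma decD x y f g : dec x f -> dec y g -> dec (x + y) (f + g).
Proof.
move=> [hf ->] [hg ->]; split=> [i|].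
  by rewrite laurentDE; apply: gradingD.
pose F := (finsupp f `|` finsupp g `|` finsupp (f + g)%R)%fset.
have h1 : (finsupp f `<=` F)%fset by rewrite /F -fsetUA fsubsetUl.
have h2 : (finsupp g `<=` F)%fset by rewrite /F fsetUAC fsubsetUr.
have h3 : (finsupp (f + g)%R `<=` F)%fset by rewrite /F fsubsetUr.
rewrite (laurent_total h1) (laurent_total h2) (laurent_total h3) -big_split.
by apply: eq_bigr => i _; rewrite laurentDE.
Qed.

Lemma decM x y f g : dec x f -> dec y g -> dec (x * y) (f * g).
Proof.
move=> [hf ->] [hg ->]; split=> [i|].
  rewrite laurentME; elim/big_ind: _ => [|u v|l _]; [exact: grading0|exact: gradingD|].
  elim/big_ind: _ => [|u v|l' _]; [exact: grading0|exact: gradingD|].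
  case: eqP => [<-|_]; last by rewrite mulr0n; apply: grading0.
  by rewrite mulr1n; apply: (gradingM gR).
have := lmul_sum (fun=> 1) f g; under eq_bigr do rewrite mul1r.
rewrite [lmul f g]/(f * g) => ->; rewrite mulr_suml; apply: eq_bigr => i _.
by rewrite mulr_sumr; apply: eq_bigr => l _; rewrite mul1r.
Qed.

Lemma laurent_lowest f i : f i != 0 ->
  exists a, f a != 0 /\ forall l, f l != 0 -> a <= l.
Proof.
have seq_min (s : seq int) b : b \in s -> exists2 a, a \in s & forall l, l \in s -> a <= l.
  elim: s b => // b s IH c _; case: s IH => [|d s] IH.
    by exists b; rewrite ?mem_head // => l; rewrite inE => /eqP->.
  have [a ha hmin] := IH d (mem_head _ _).
  have [ab|ba] := lerP a b.
    exists a; first by rewrite inE ha orbT.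
    by move=> l; rewrite inE => /orP[/eqP->|/hmin].
  exists b; first exact: mem_head.
  by move=> l; rewrite inE => /orP[/eqP->//|/hmin]; apply: le_trans; apply: ltW.
rewrite -mem_finsupp => /(seq_min (finsupp f))[a ha hmin].
exists a; split; first by rewrite -mem_finsupp.
by move=> l hl; apply: hmin; rewrite -[_ \in _]/(l \in finsupp f) mem_finsupp.
Qed.

Lemma laurent_lowestM f g a b : f a != 0 -> g b != 0 ->
  (forall l, f l != 0 -> a <= l) -> (forall l, g l != 0 -> b <= l) -> (f * g) (a + b) != 0.
Proof.
move=> fa gb fmin gmin; suff -> : (f * g) (a + b) = f a * g b by rewrite mulf_neq0.
rewrite laurentME (bigD1_seq a) ?fset_uniq ?mem_finsupp //=.
rewrite (bigD1_seq b) ?fset_uniq ?mem_finsupp //= eqxx mulr1n.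
rewrite [X in _ + X + _]big1 => [|l lb]; last first.
  by case: eqP => // e; case/eqP: lb; apply: (addrI a).
rewrite addr0 big_seq_cond [X in _ + X]big1 ?addr0 // => l.
rewrite mem_finsupp => /andP[/fmin al la].
rewrite big_seq big1 // => l'; rewrite mem_finsupp => /gmin bl.
case: eqP => // e; case/eqP: la; lia.
Qed.

Hypothesis dR : determined_by_grading R deg.
Hypothesis degC : forall c : k, c != 0 -> deg c%:MP = Some 0.

Lemma homog_deg i x : R i x -> x != 0 -> deg x = Some i.
Proof.
move=> hx x0; have [[e|[l -> hl]] hU] := dR (dec_term hx).
  have := hU (Some i); rewrite e /= => h; suff : false by [].
  by apply: h; right; exists i => //; rewrite ltermE eqxx.
by move: hl; rewrite ltermE; case: (l =P i) => [->|_]; rewrite ?eqxx.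
Qed.

Lemma homog_le i x : R i x -> dle (deg x) (Some i).
Proof.
move=> hx; have [->|x0] := eqVneq x 0; first by rewrite degree0.
by rewrite (homog_deg hx x0) /= lexx.
Qed.

Lemma dec_le x f i l : dec x f -> dle (deg x) (Some i) -> f l != 0 -> l <= i.
Proof.
move=> hx hi hl; have [_ /(_ (Some l))] := dR hx.
have h : Some l = None \/ (exists2 i0, Some l = Some i0 & f i0 != 0) by right; exists l.
by move/(_ h) => h'; apply: (dle_trans (y := deg x) h' hi).
Qed.

(** A grading is here only one of rings, so this needs proof. The components of constants have
    degree at most 0. If a is the lowest degree in 1, then 1 * 1 = 1 gives a <= 2a, so 1 is in
    degree 0; the lowest degrees in c and c^-1 then add up to 0, so both are 0. *)
Lemma const_homog c : R 0 c%:MP.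
Proof.
have [->|c0] := eqVneq c 0; first by rewrite mpolyC0; apply: grading0.
have le0 (d : k) f l : d != 0 -> dec d%:MP f -> f l != 0 -> l <= 0.
  by move=> d0 hf; apply: (dec_le hf); rewrite degC.
have nz (d : k) f : d != 0 -> dec d%:MP f -> exists i, f i != 0.
  move=> d0 [_ e]; apply: contrapT => hN; case/negP: d0; rewrite -(mpolyC_eq0 2).
  rewrite e big1 // => i _; apply/eqP; apply: contraT => hi.
  by case: hN; exists i.
have [h hh] := dec_ex 1%:MP; have [f hf] := dec_ex c%:MP; have [g hg] := dec_ex c^-1%:MP.
have h0 i : h i != 0 -> i = 0.
  have [l hl] := nz 1 h (oner_neq0 _) hh.
  have [a [ha hmin]] := laurent_lowest hl.
  have : (h * h) (a + a) != 0 by apply: laurent_lowestM.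
  have hh2 := decM hh hh; rewrite -mpolyCM mulr1 in hh2.
  rewrite (dec_uniq hh2 hh).
  move=> /hmin aa hi; have := hmin _ hi; have := le0 1 h i (oner_neq0 _) hh hi; lia.
have [l hl] := nz c f c0 hf; have [a [fa fmin]] := laurent_lowest hl.
have cv0 : c^-1 != 0 by rewrite invr_eq0.
have [l' hl'] := nz _ g cv0 hg; have [b [gb gmin]] := laurent_lowest hl'.
have ab : a + b = 0.
  apply: h0; have <- : f * g = h by apply: dec_uniq hh; rewrite -(mulfV c0) mpolyCM; apply: decM.
  exact: laurent_lowestM.
have a_le := le0 _ _ _ c0 hf fa; have b_le := le0 _ _ _ cv0 hg gb.
have sf : (finsupp f `<=` [fset 0])%fset.
  apply/fsubsetP => i; rewrite mem_finsupp => fi; rewrite inE.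
  have := fmin _ fi; have := le0 _ _ _ c0 hf fi => h1 h2; apply/eqP; lia.
have [fR ->] := hf.
by rewrite (laurent_total sf) big_seq_fset1.
Qed.

(** For such a degree function Gr(B) is a copy of B, generated by the classes of the homogeneous
    components of X and Y. *)
Lemma determined_gr_finitely_generated : gr_finitely_generated (@mpolyC 2 k) deg.
Proof.
have hdeg c : dle (deg (@mpolyC 2 k c)) (Some 0).
  by have [->|c0] := eqVneq c 0; rewrite ?mpolyC0 ?degree0 // degC /=.
have [fX hX] := dec_ex 'X_0; have [fY hY] := dec_ex 'X_1.
pose s := [seq gr_class deg i (fX i) | i <- finsupp fX]
  ++ [seq gr_class deg i (fY i) | i <- finsupp fY].
pose v (l : 'I_(size s)) := s`_l; exists (size s), v.
change (forall a, gen (iota := @mpolyC 2 k) hdeg v a).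
pose G := gen (iota := @mpolyC 2 k) hdeg v.
have G0 : G 0 by apply: gen0.
have GD a b : G a -> G b -> G (a + b) by apply: genD.
have GM a b : G a -> G b -> G (a * b) by apply: genM.
have Gs a : a \in s -> G a.
  move=> sa; have hi : (index a s < size s)%N by rewrite index_mem.
  by have := gen_var (iota := @mpolyC 2 k) hdeg v (Ordinal hi); rewrite /v nth_index.
have gr0 i : gr_class deg i 0 = 0 by apply/gr_class_eq0; rewrite degree0.
pose P x := exists2 f : laurent B, dec x f & forall i, G (gr_class deg i (f i)).
have PD x y : P x -> P y -> P (x + y).
  move=> [f hf Pf] [g hg Pg]; exists (f + g); first exact: decD.
  move=> i; rewrite laurentDE gr_classD; first exact: GD.
    by apply: homog_le; case: hf.
  by apply: homog_le; case: hg.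
have PM x y : P x -> P y -> P (x * y).
  move=> [f hf Pf] [g hg Pg]; exists (f * g); first exact: decM.
  have fR := hf.1; have gRR := hg.1.
  move=> i; rewrite laurentME.
  suff [] : R i (\sum_(i0 <- finsupp f) \sum_(j <- finsupp g) (f i0 * g j) *+ (i0 + j == i)) /\
    G (gr_class deg i (\sum_(i0 <- finsupp f) \sum_(j <- finsupp g) (f i0 * g j) *+ (i0 + j ==
      i))) by [].
  pose Q z := R i z /\ G (gr_class deg i z).
  have Q0 : Q 0 by split; [apply: grading0|rewrite gr0].
  have QD z t : Q z -> Q t -> Q (z + t).
    move=> [Rz Gz] [Rt Gt]; split; first exact: gradingD.
    by rewrite gr_classD; [apply: GD|apply: homog_le|apply: homog_le].
  apply: (big_ind Q) => // l _; apply: (big_ind Q) => // l' _.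
  case: eqP => [e|_]; last by rewrite mulr0n.
  rewrite mulr1n /Q -e; split; first exact: (gradingM gR).
  by rewrite -gr_classM; [apply: GM|apply: homog_le|apply: homog_le].
have PC c : P c%:MP.
  exists (lterm 0 c%:MP); first exact/dec_term/const_homog.
  move=> i; rewrite ltermE; case: eqP => [->|_]; last by rewrite gr0.
  exact: (genC (iota := @mpolyC 2 k)).
have PX : P 'X_0.
  exists fX => // i; have [hi|hi] := finsuppP fX i; first by rewrite gr0.
  by apply: Gs; rewrite mem_cat; apply/orP; left; apply/mapP; exists i.
have PY : P 'X_1.
  exists fY => // i; have [hi|hi] := finsuppP fY i; first by rewrite gr0.
  by apply: Gs; rewrite mem_cat; apply/orP; right; apply/mapP; exists i.
have PXn x n : P x -> P (x ^+ n).
  by move=> Px; elim: n => [|n IH]; [rewrite expr0 -mpolyC1|rewrite exprS; apply: (PM)].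
have Pall x : P x.
  elim/mpolyind: x => [|c m p _ _ Pp]; first by rewrite -(mpolyC0 2 k).
  apply: PD => //; rewrite -mul_mpolyC; apply: (PM) => //.
  rewrite mpolyXE_id !big_ord_recl big_ord0 mulr1.
  have -> : lift ord0 ord0 = 1 :> 'I_2 by apply: val_inj.
  by apply: (PM); apply: PXn.
apply: gr_ind => // i x hx; have [f hf Gf] := Pall x.
have [fR xe] := hf.
(* As x has degree at most i, its components other than [f i] have degree less than i and vanish in
   B_[i]. *)
suff -> : gr_class deg i x = gr_class deg i (f i) by apply: Gf.
apply: gr_class_congr => //; first exact/homog_le/fR.
rewrite xe (laurent_total (fsubsetUl _ [fset i]%fset)).
rewrite (bigD1_seq i) ?fset_uniq ?inE ?eqxx ?orbT //= addrAC subrr add0r.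
rewrite dltSE big_seq_cond; elim/big_ind: _ => [|y z|l /andP[_ li]].
- by rewrite degree0.
- exact: dle_degD.
have [->|fl] := eqVneq (f l) 0; first by rewrite degree0.
rewrite (homog_deg (fR l) fl) /=.
by have := dec_le hf hx fl; move: li; lia.
Qed.

End GradedDomain.

(** * The weight grading, for [beta 0] transcendental over k *)

Section WeightGrading.
Variables (k L : fieldType) (j : {rmorphism k -> L}) (beta : nat -> L).
Hypothesis lead_ex : forall x : {mpoly L[2]}, x != 0 ->
  exists d c, c != 0 /\ lead beta d x c.
Hypothesis trans : forall p : {poly k}, p != 0 -> (map_poly j p).[beta 0] != 0.
Local Notation B := {mpoly k[2]}.
Local Notation deg := (degk lead_ex j).

Lemma msupp_zero : msupp (0 : B) = [::].
Proof. by apply/eqP; rewrite msupp_eq0. Qed.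

Definition wtR (i : int) (p : B) : Prop := forall m, m \in msupp p -> (wt m)%:Z = i.

(** The coefficient in the top weight w is P(beta_0), where P collects the terms of weight w by
    their Y-exponent. Monomials of equal weight differ in that exponent, so P is non-zero, and
    [trans] applies. *)
Lemma degk_weight (x : B) : x != 0 -> exists w : nat,
  [/\ deg x = Some w%:Z, exists2 m, m \in msupp x & wt m = w &
      forall m, m \in msupp x -> (wt m <= w)%N].
Proof.
move=> x0; have hex : exists n, has (fun m => wt m == n) (msupp x).
  case e : (msupp x) => [|m s]; first by move/eqP: e; rewrite msupp_eq0 (negbTE x0).
  by exists (wt m); rewrite /= eqxx.
have hub n : has (fun m => wt m == n) (msupp x) -> (n <= \sum_(m <- msupp x) wt m)%N.
  by move=> /hasP[m ms /eqP<-]; rewrite (big_rem m) //= leq_addr.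
case: (ex_maxnP hex hub) => w /hasP[m0 ms0 /eqP em0] hmax.
have wle m : m \in msupp x -> (wt m <= w)%N by move=> ms; apply: hmax; apply/hasP; exists m.
exists w; split=> //; last by exists m0.
pose P : {poly k} := \sum_(m <- msupp x | wt m == w) x@_m *: 'X^(m 1).
pose cf m := j x@_m * (if wt m == w then beta 0 ^+ m 1 else 0).
have hl : leadk beta j w%:Z x (\sum_(m <- msupp x) cf m).
  rewrite {1}(mpolyE x); apply: leadk_sum => m ms; apply: leadkZ.
  case: eqP => [<-|/eqP ne]; first exact: leadk_mon.
  apply: (lead_lt (leadk_mon beta j m)); rewrite ltz_nat.
  by rewrite ltn_neqAle ne wle.
have eP : (map_poly j P).[beta 0] = \sum_(m <- msupp x) cf m.
  rewrite rmorph_sum horner_sum big_mkcond; apply: eq_bigr => m _.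
  rewrite /cf; case: eqP => _; last by rewrite mulr0.
  by rewrite /= map_polyZ map_polyXn hornerZ hornerXn.
apply: (degkE lead_ex hl); rewrite -eP; apply: trans.
apply/eqP => P0; have := congr1 (fun p : {poly k} => p`_(m0 1)) P0.
rewrite coef0 coef_sum big_mkcond (bigD1_seq m0) ?msupp_uniq //= em0 eqxx.
rewrite coefZ coefXn eqxx mulr1 big1 ?addr0 => [/eqP|m mm]; first by rewrite mcoeff_eq0 ms0.
case: (wt m =P w) => // hm; rewrite coefZ coefXn.
case: (m0 1 =P m 1) => [e|_]; last by rewrite mulr0.
by case/eqP: mm; apply: wt_inj; rewrite ?hm ?em0.
Qed.

Lemma degk_weight_le (x : B) i m : dle (deg x) (Some i) -> m \in msupp x -> (wt m)%:Z <= i.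
Proof.
have [->|x0] := eqVneq x 0; first by rewrite msupp_zero.
have [w [-> _ hw]] := degk_weight x0 => /= wi ms.
by apply: le_trans wi; rewrite lez_nat hw.
Qed.

(** Reading a decomposition off its coefficients makes uniqueness immediate. *)
Lemma wtR_coef (x : B) (f : laurent B) : homogeneous_decomposition wtR x f <->
  forall i m, (f i)@_m = if (wt m)%:Z == i then x@_m else 0.
Proof.
have total (h : laurent B) m : (forall i, (wt m)%:Z != i -> (h i)@_m = 0) ->
    (\sum_(i <- finsupp h) h i)@_m = (h (wt m)%:Z)@_m.
  move=> hh; rewrite raddf_sum /=; have [hn|hn] := finsuppP h (wt m)%:Z.
    rewrite mcoeff0 big_seq big1 // => i hi; apply: hh.
    by apply: contraNneq hn => ->.
  rewrite (bigD1_seq (wt m)%:Z) ?fset_uniq //= big1 ?addr0 // => i hi.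
  by apply: hh; rewrite eq_sym.
split=> [[hf ex] i m|hc].
  have off l n : (wt n)%:Z != l -> (f l)@_n = 0.
    by move=> hn; apply/eqP; rewrite mcoeff_eq0; apply: contraNN hn => /hf ->.
  case: eqP => [<-|/eqP/off //].
  by rewrite ex total // => l; apply: off.
split=> [i m|].
  by rewrite mcoeff_msupp hc; case: ((wt m)%:Z =P i) => //; rewrite eqxx.
apply/mpolyP => m; rewrite total ?hc ?eqxx // => i /negbTE hi.
by rewrite hc hi.
Qed.

Lemma weight_is_grading : is_grading wtR.
Proof.
split=> [i m|i x y hx hy m|i l x y hx hy m|x].
- by rewrite msupp_zero.
- move=> /msuppB_le; rewrite mem_cat => /orP[]; [exact: hx|exact: hy].
- move=> /msuppM_le /allpairsP[[m1 m2] /= [h1 h2 ->]].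
  by rewrite wtD PoszD (hx _ h1) (hy _ h2).
pose S := [fset (wt m)%:Z | m in msupp x]%fset.
pose f : laurent B := [fsfun i in S => \sum_(m <- msupp x | (wt m)%:Z == i) x@_m *: 'X_[m]].
have hf : homogeneous_decomposition wtR x f.
  apply/wtR_coef => i m; have -> : f i = \sum_(m <- msupp x | (wt m)%:Z == i) x@_m *: 'X_[m].
    rewrite fsfunE; case: ifPn => // hi; rewrite big_seq_cond big1 // => n /andP[hn /eqP e].
    by case/negP: hi; rewrite -e; apply: in_imfset.
  rewrite raddf_sum /=; have [hm|hm] := boolP (m \in msupp x); last first.
    rewrite (memN_msupp_eq0 hm) if_same big_seq_cond big1 // => n /andP[hn _].
    rewrite mcoeffZ mcoeffX; case: eqP => [e|_]; last by rewrite mulr0.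
    by rewrite -e hn in hm.
  rewrite big_mkcond (bigD1_seq m) ?msupp_uniq //= [X in _ + X]big1 => [|n nm].
    by rewrite addr0; case: ifP => // _; rewrite mcoeffZ mcoeffX eqxx mulr1.
  by case: ifP => // _; rewrite mcoeffZ mcoeffX (negbTE nm) mulr0.
exists f; split=> // g /wtR_coef hg; apply/fsfunP => i; apply/mpolyP => m.
by move/wtR_coef: hf => ->; rewrite hg.
Qed.

Lemma weight_grading23 : XY_weight23_grading wtR.
Proof.
have wtX : wt U_(0%R) = 2%N by rewrite /wt !mnm1E.
have wtY : wt U_(1%R) = 3%N by rewrite /wt !mnm1E.
split; first exact: weight_is_grading.
- move=> i p i0 hp; apply/eqP; rewrite -msupp_eq0.
  case e : (msupp p) => [|m s] //.
  by have := hp m; rewrite e mem_head => /(_ isT) h; lia.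
- move=> p; split=> [hp|[c ->] m].
    exists p@_0%MM; apply/mpolyP => m; rewrite mcoeffC.
    have [<-|m0] := eqVneq 0%MM m; first by rewrite mulr1.
    rewrite mulr0; apply/eqP; rewrite mcoeff_eq0; apply: contraNN m0 => /hp h.
    by apply/eqP; apply: wt_inj; move: h; rewrite /wt !mnm0E; lia.
  rewrite msuppC; case: eqP => // _; rewrite inE => /eqP->.
  by rewrite /wt !mnm0E.
- by move=> m; rewrite msuppX inE => /eqP->; rewrite wtX.
- by move=> m; rewrite msuppX inE => /eqP->; rewrite wtY.
Qed.

Lemma weight_determined : determined_by_grading wtR deg.
Proof.
move=> x f /wtR_coef hf; have [x0|x0] := eqVneq x 0.
  rewrite x0 degree0; split; first by left.
  move=> v [->//|[i -> /eqP]]; case; apply/mpolyP => m.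
  by rewrite hf x0 !mcoeff0 if_same.
have [w [-> [m ms em] hw]] := degk_weight x0; split.
  right; exists w%:Z => //; apply/eqP => /mpolyP/(_ m) /eqP.
  by rewrite hf em eqxx mcoeff0 mcoeff_eq0 ms.
move=> v [->//|[i -> fi]] /=.
case e : (msupp (f i)) => [|n s]; first by move/eqP: e; rewrite msupp_eq0 (negbTE fi).
have : n \in msupp (f i) by rewrite e mem_head.
rewrite mcoeff_msupp hf; case: ((wt n)%:Z =P i) => [<-|]; last by rewrite eqxx.
by rewrite -mcoeff_msupp lez_nat => /hw.
Qed.

(** The classes of X and Y generate: in the class of x in B_[i], the monomials of weight less than i
    vanish and those of weight i are products of these classes. *)
Lemma weight_gr_finitely_generated : gr_finitely_generated (@mpolyC 2 k) deg.
Proof.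
have hdeg := degkC_le lead_ex j.
have dX : dle (deg 'X_0) (Some 2) by apply/(leadk_degk lead_ex); exists 1; apply: leadkX.
have dY : dle (deg 'X_1) (Some 3) by apply/(leadk_degk lead_ex); exists (beta 0); apply: leadkY.
pose w (i : 'I_2) := if i == 0 then gr_class deg 2 'X_0 else gr_class deg 3 'X_1.
exists 2%N, w => a; change (gen (iota := @mpolyC 2 k) hdeg w a).
move: a; apply: gr_ind => [|a b|i x hx]; [exact: gen0|exact: genD|].
pose G := gen (iota := @mpolyC 2 k) hdeg w.
suff [] : dle (deg x) (Some i) /\ G (gr_class deg i x) by [].
rewrite (mpolyE x) big_seq; elim/big_ind: _ => [|y z [dy Gy] [dz Gz]|m ms].
- by rewrite degree0; split=> //; rewrite (gr_class_eq0 _).2 ?degree0 //; apply: gen0.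
- split; first exact: dle_degD.
  rewrite gr_classD; [exact: (genD Gy Gz)|exact: dy|exact: dz].
have hm := degk_weight_le hx ms.
have hl : leadk beta j (wt m)%:Z (x@_m *: 'X_[m]) (j x@_m * beta 0 ^+ m 1).
  by apply: leadkZ; apply: leadk_mon.
have dm : dle (deg (x@_m *: 'X_[m])) (Some (wt m)%:Z).
  by apply/(leadk_degk lead_ex); exists (j x@_m * beta 0 ^+ m 1).
have dmi : dle (deg (x@_m *: 'X_[m])) (Some i) by apply: dle_trans dm _.
split=> //; move: hm; rewrite le_eqVlt => /orP[/eqP<-|lt_m]; last first.
  have h0 : dlt (deg (x@_m *: 'X_[m])) (Some i).
    by apply: (leadk_degk_lt lead_ex j i _).1; apply: (lead_lt hl).
  by rewrite (gr_class_eq0 dmi).2 //; apply: gen0.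
have eX := gr_class_exp (m 0) dX; have eY := gr_class_exp (m 1) dY.
have -> : x@_m *: 'X_[m] = (x@_m)%:MP * ('X_0 ^+ m 0 * 'X_1 ^+ m 1).
  rewrite mul_mpolyC mpolyXE_id !big_ord_recl big_ord0 mulr1.
  by have -> : lift ord0 ord0 = 1 :> 'I_2 by apply: val_inj.
have -> : (wt m)%:Z = 0 + (2 *+ m 0 + 3 *+ m 1) by rewrite /wt; lia.
rewrite -gr_classM ?hdeg //; last by apply: dle_degM; [exact: eX.1|exact: eY.1].
rewrite -gr_classM; [|exact: eX.1|exact: eY.1].
apply: genM; first exact: (genC (iota := @mpolyC 2 k)).
rewrite -eX.2 -eY.2; apply: genM; apply: genXn.
  exact: (gen_var (iota := @mpolyC 2 k) hdeg w 0).
exact: (gen_var (iota := @mpolyC 2 k) hdeg w 1).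
Qed.

(** The value -3 is attained at Y, and D lowers by 3 the weight of each monomial that it does not
    kill. *)
Lemma weight_derivation_degree : derivation_degree_defined deg (mderiv 1).
Proof.
have Xf : ('X_1 : B) != 0 by rewrite -msize_poly_eq0 msizeX.
have DY : mderiv 1 ('X_1 : B) = 1.
  rewrite mderivX mnm1E eqxx scale1r (_ : (_ - _)%MM = 0%MM) ?mpolyX0 //.
  by apply/mnmP => i; rewrite mnmBE mnm0E subnn.
have b0 : beta 0 != 0.
  by have := trans (p := 'X) (negbT (polyX_eq0 _)); rewrite map_polyX hornerX.
have dY : deg 'X_1 = Some 3 by apply: degkE (leadkY beta j) b0.
exists (Some (- 3)); split.
  exists 'X_1; first exact: Xf.
  by rewrite DY -mpolyC1 degkC ?oner_neq0 // dY.
move=> _ [x x0 ->]; have [D0|D0] := eqVneq (mderiv 1 x) 0.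
  by rewrite D0 degree0.
have [w [-> _ hw]] := degk_weight x0.
have [w' [-> [m ms <-] _]] := degk_weight D0.
have : (m + U_(1%R))%MM \in msupp x.
  rewrite mcoeff_msupp; apply: contraTneq ms => h.
  by rewrite mcoeff_msupp mcoeff_deriv h mul0rn eqxx.
move/hw; rewrite wtD [wt U_(1%R)]/wt !mnm1E /=; lia.
Qed.

End WeightGrading.

(** * No grading when the degrees fill Z *)

Section ClosedNotDetermined.
Variables (L : fieldType) (beta : nat -> L).
Hypothesis lead_ex : forall x : {mpoly L[2]}, x != 0 ->
  exists d c, c != 0 /\ lead beta d x c.
Hypothesis beta0 : beta 0 != 0.
Local Notation j := (idfun : {rmorphism L -> L}).
Local Notation deg := (degk lead_ex j).

(* Degree 1 and degree -1 homogeneous elements would have a constant product. *)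
Lemma not_determined_closed : not_determined_by_a_grading deg.
Proof.
case=> R [gR dR]; have degC := degkC lead_ex j.
have [u [v [hu hv]]] := unit_degrees lead_ex beta0.
have top i x : deg x = Some i -> exists y, [/\ R i y, y != 0 & deg y = Some i].
  move=> ex; have [f hf] := dec_ex gR x.
  have [[e|[l e fl]] _] := dR _ _ hf; first by rewrite ex in e.
  move: e fl; rewrite ex => -[<-] fi; exists (f i).
  by split; [exact: hf.1|exact: fi|exact: (homog_deg gR dR (hf.1 i) fi)].
have [U [RU U0 dU]] := top _ _ (degkE lead_ex hu (oner_neq0 _)).
have [V [RV V0 dV]] := top _ _ (degkE lead_ex hv (oner_neq0 _)).
have RUV := gradingM gR RU RV; rewrite subrr in RUV.
have [c hc] := (leadk_degk lead_ex j 0 _).1 (homog_le gR dR RUV).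
(* Subtracting from U V its coefficient in degree 0 leaves an element of R 0 of negative degree,
   which must be zero. *)
have UVc : U * V = c%:MP.
  apply/eqP; rewrite -subr_eq0; apply: contraT => n0.
  have Rd : R 0 (U * V - c%:MP) := gradingB gR RUV (const_homog gR dR degC c).
  have h := leadkD hc (leadkC beta j (- c)); rewrite subrr mpolyCN in h.
  by have := (leadk_degk_lt lead_ex j 0 _).1 h; rewrite (homog_deg gR dR Rd n0).
have UV0 : U * V != 0 by rewrite mulf_neq0.
have := msizeM U0 V0; rewrite UVc msizeC.
have -> : c != 0 by apply: contraNneq UV0 => c0; rewrite UVc c0 mpolyC0.
have sU : (0 < msize U)%N by rewrite lt0n msize_poly_eq0.
have sV : (0 < msize V)%N by rewrite lt0n msize_poly_eq0.
(* Total degrees add up to 0, so U is a constant and has degree 0, not 1. *)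
move=> e; have U1 : (msize U <= 1)%N.
  by move: e sU sV; move: (msize U) (msize V) => p q /=; lia.
have eU := msize1_polyC U1; have c0 : U@_0%MM != 0.
  by apply: contraNneq U0 => c0; rewrite eU c0 mpolyC0.
by move: dU; rewrite eU degC.
Qed.

End ClosedNotDetermined.

(** * Algebraic extension of the constants *)

Section ConstantExtension.
Variables (k K : fieldType) (iota : {rmorphism k -> K}).
Hypothesis alg : forall z : K, algebraicOver iota z.
Local Notation ext := (map_mpoly iota : {rmorphism {mpoly k[2]} -> {mpoly K[2]}}).

Lemma mpoly_integral (x : {mpoly K[2]}) : integralOver ext x.
Proof.
elim/mpolyind: x => [|c m p _ _ IH]; first exact: integral0.
apply: integral_add => //; rewrite -mul_mpolyC; apply: integral_mul; last first.
  by have := integral_id ext 'X_[m]; rewrite /= map_mpolyX.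
have [p0 p0mon p0c] := (integral_algebraic iota c).1 (alg c).
exists (map_poly (@mpolyC 2 k) p0); first exact: monic_map.
have -> : map_poly ext (map_poly (@mpolyC 2 k) p0) = map_poly (@mpolyC 2 K) (map_poly iota p0).
  rewrite -!map_poly_comp; apply: eq_map_poly => a /=.
  by rewrite map_mpolyC.
by apply/eqP; rewrite horner_map (eqP p0c) rmorph0.
Qed.

(** In a monic relation for x over k[X,Y], powers of x are divided out until the constant term is
    non-zero; that term is then a multiple of x. This carries the existence of degrees from k_1 to
    k_2. *)
Lemma nonzero_multiple (x : {mpoly K[2]}) : x != 0 ->
  exists (y : {mpoly K[2]}) (f : {mpoly k[2]}), f != 0 /\ x * y = map_mpoly iota f.
Proof.
move=> x0; have [p pmon px] := mpoly_integral x.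
have := monic_neq0 pmon; move: px; elim/poly_ind: p {pmon} => [|p c IH]; first by rewrite eqxx.
rewrite /root rmorphD rmorphM /= map_polyX map_polyC hornerD hornerMX hornerC => px pc0.
have [c0|c0] := eqVneq c 0.
  move: px; rewrite c0 raddf0 addr0 mulf_eq0 => /orP[px|/eqP e]; last by rewrite e eqxx in x0.
  by apply: (IH px); apply: contraNneq pc0 => ->; rewrite c0 mul0r addr0.
exists (- (map_poly ext p).[x]), c; split=> //.
by apply/eqP; rewrite mulrN mulrC eqr_oppLR -addr_eq0.
Qed.

End ConstantExtension.

Lemma map_mpoly_trans (k0 k1 k2 : fieldType) (i01 : {rmorphism k0 -> k1})
    (i12 : {rmorphism k1 -> k2}) (p : {mpoly k0[2]}) :
  map_mpoly i12 (map_mpoly i01 p) = map_mpoly (i12 \o i01) p.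
Proof. by apply/mpolyP => m; rewrite !mcoeff_map_mpoly. Qed.

Lemma map_mpoly_idfun (k : fieldType) (p : {mpoly k[2]}) :
  map_mpoly (idfun : {rmorphism k -> k}) p = p.
Proof. by apply/mpolyP => m; rewrite mcoeff_map_mpoly. Qed.

Theorem proposition1p5
    (k0 k1 : fieldType) (k2 : closedFieldType)
    (i01 : {rmorphism k0 -> k1}) (i12 : {rmorphism k1 -> k2})
    (k0_uncountable : uncountable k0)
    (k0_char0 : [pchar k0] =i pred0)
    (k1_function_field : function_field i01)
    (k2_closure : algebraic_closure i12) :
  exists (deg0 : degree_function {mpoly k0[2]})
         (deg1 : degree_function {mpoly k1[2]})
         (deg2 : degree_function {mpoly k2[2]}),
    (nat_valued deg0 /\ nat_valued deg1)
    (* (a) *)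
    /\ [/\ forall p, deg1 (map_mpoly i01 p) = deg0 p,
           forall p, deg2 (map_mpoly i12 p) = deg1 p &
           forall p, deg2 (map_mpoly i12 (map_mpoly i01 p)) = deg0 p]
    (* (b) *)
    /\ [/\ forall c : k0, c != 0 -> deg0 c%:MP = Some 0,
           forall c : k1, c != 0 -> deg1 c%:MP = Some 0 &
           forall c : k2, c != 0 -> deg2 c%:MP = Some 0]
    (* (c) *)
    /\ [/\ exists2 R, XY_weight23_grading R & determined_by_grading R deg0,
           not_determined_by_a_grading deg1 &
           not_determined_by_a_grading deg2]
    (* (d) *)
    /\ [/\ gr_finitely_generated (@mpolyC 2 k0) deg0,
           ~ gr_finitely_generated (@mpolyC 2 k1) deg1 &
           gr_finitely_generated (@mpolyC 2 k2) deg2]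
    (* (e) *)
    /\ [/\ derivation_degree_defined deg0 (mderiv 1),
           ~ derivation_degree_defined deg1 (mderiv 1) &
           ~ derivation_degree_defined deg2 (mderiv 1)].
Proof.
have [tau [tau_trans [K [a [K0 hK]]]]] := function_field_tower i12 k1_function_field.
have k2_char0 : [pchar k2] =i pred0.
  by move=> p; rewrite (fmorph_pchar i12) (fmorph_pchar i01) k0_char0.
(* The coefficients of u^3, u^2, u, ... in y: first tau, then the square roots. *)
pose beta n := if n is m.+1 then a m else i12 tau.
have hKi n : intermediate_field i12 (K n) by case: (hK n).
(* The first level is repeated, since [beta 0] = tau already lies in k_1. *)
pose KK n : divringClosed k2 := field_pred (hKi n.-1).
have KK_sub n : {subset KK n <= KK n.+1}.
  move=> x /field_predP hx; apply/field_predP; case: n hx => // n hx.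
  by have [_ h _ _ _] := hK n; apply: h.
have betaK n : beta n \in KK n.+1.
  apply/field_predP; case: n => [|n] /=; first exact: intermediate_base (hKi 0) _.
  by case: (hK n).
have betaN n : beta n.+1 \notin KK n.+1.
  by apply/negP => /field_predP; case: (hK n).
have betaK2 n : beta n.+1 ^+ 2 \in KK n.+1.
  by apply/field_predP; case: (hK n).
have two0 : (2%:R : k2) != 0 by have /pcharf0P -> := k2_char0.
have lead_k1 (f : {mpoly k1[2]}) : f != 0 ->
    exists (d : nat) c, c != 0 /\ lead beta d%:Z (map_mpoly i12 f) c.
  move=> f0; apply: (lead_exists_K two0 KK_sub betaK betaN betaK2).
    move=> m; rewrite mcoeff_map_mpoly; apply/field_predP.
    exact: intermediate_base (hKi 0) _.
  by rewrite -(rmorph0 (map_mpoly i12)) (inj_eq (@map_mpoly_inj _ _ i12)).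
(* A non-zero multiple of x over k_1 has a leading coefficient, and [lead_factor] passes it on to
   x. *)
have lead_ex (x : {mpoly k2[2]}) : x != 0 -> exists d c, c != 0 /\ lead beta d x c.
  move=> /(nonzero_multiple k2_closure)[y [f [/lead_k1[d [c [c0 hc]]] e]]].
  by apply: (lead_factor (y := y) c0); rewrite e; apply: hc.
have beta_trans (p : {poly k0}) : p != 0 -> (map_poly (i12 \o i01) p).[beta 0] != 0.
  move=> /tau_trans; rewrite map_poly_comp horner_map fmorph_eq0; exact.
have beta0 : beta 0 != 0.
  by have := beta_trans 'X (negbT (polyX_eq0 _)); rewrite map_polyX hornerX.
have ge0 : nat_valued (degk lead_ex i12).
  move=> f d ed; have [f0|/lead_k1[n [c [c0 hc]]]] := eqVneq f 0.
    by rewrite f0 degree0 in ed.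
  by move: ed; rewrite (degkE lead_ex hc c0) => -[<-].
have comp01 (p : {mpoly k0[2]}) :
    degk lead_ex i12 (map_mpoly i01 p) = degk lead_ex (i12 \o i01) p.
  by rewrite [LHS]/(ldeg beta _) map_mpoly_trans.
have comp12 (p : {mpoly k1[2]}) :
    degk lead_ex (idfun : {rmorphism k2 -> k2}) (map_mpoly i12 p) = degk lead_ex i12 p.
  by rewrite [LHS]/(ldeg beta _) map_mpoly_idfun.
have id_alg (z : k2) : algebraicOver (idfun : {rmorphism k2 -> k2}) z by apply: algebraic_id.
exists (degk lead_ex (i12 \o i01)), (degk lead_ex i12),
  (degk lead_ex (idfun : {rmorphism k2 -> k2})).
split; first by split; [move=> p d; rewrite -comp01; exact: ge0|exact: ge0].
split.
  split; [exact: comp01|exact: comp12|].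
  by move=> p; rewrite comp12 comp01.
split.
  split; [exact: (degkC lead_ex (i12 \o i01))|exact: (degkC lead_ex i12)|].
  exact: (degkC lead_ex (idfun : {rmorphism k2 -> k2})).
have not_fg := gr_not_finitely_generated (lead_ex := lead_ex) ge0 k2_closure.
split.
  split.
  - exists (@wtR k0); first exact: weight_grading23.
    exact: (weight_determined lead_ex beta_trans).
  (* A grading would make Gr(B_1) finitely generated, so this part of (c) follows from (d). *)
  - case=> R [gR dR]; apply: not_fg.
    exact: (determined_gr_finitely_generated gR dR (degkC lead_ex i12)).
  - exact: (not_determined_closed beta0).
split.
  split; [exact: (weight_gr_finitely_generated lead_ex beta_trans)|exact: not_fg|].
  exact: (gr_finitely_generated_closed lead_ex beta0).
split; first exact: (weight_derivation_degree lead_ex beta_trans).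
  exact: (derivation_degree_undefined k2_char0 k2_closure).
exact: (derivation_degree_undefined k2_char0 id_alg).
Qed.
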